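(* Let $\zeta\ge0$ and $\kappa\ge0$ satisfy $8\zeta+\kappa<1$ and $\zeta+2\kappa<1$. Let $\{Z_n\}_{n\in\mathbb{N}}$ be a sequence of diagonal matrices $Z_n=\mathrm{diag}(z_1^{(n)},\ldots,z_n^{(n)})$ with $z_j^{(n)}\geq1$ having bounded squeezing of degree $\zeta$, such that the average energy $\lambda(n)=\frac{1}{2n}\sum_{j=1}^n(z_j^{(n)}+1/z_j^{(n)})$ is uniformly bounded in $n$, and let $\{k_n\}_{n\in\mathbb{N}}$ be a sequence of subsystem sizes bounded of degree $\kappa$; write $k=k_n$. Let $\lambda_1^{(n)},\ldots,\lambda_k^{(n)}$ be the symplectic eigenvalues of $M_{n,k}(U)$, with $U$ drawn from the Haar measure on $U(n)$. Then there are constants $C,c>0$ such that for every $\epsilon>Cn^{\zeta+2\kappa-1}$, $$\Pr\Big\{\sum_{j=1}^k\big((\lambda_j^{(n)})^2-\lambda(n)^2\big)^2>\epsilon\Big\}\leq\exp\big(-c\,\epsilon^2n^{1-8\zeta-\kappa}\big).$$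
   Context: $J_k=\begin{pmatrix}0_k&-I_k\\ I_k&0_k\end{pmatrix}$. For $U\in U(n)$, $\eta(U)=\begin{pmatrix}\mathrm{Re}(U)&\mathrm{Im}(U)\\ -\mathrm{Im}(U)&\mathrm{Re}(U)\end{pmatrix}$, $M_n(U)=\eta(U)(Z_n\oplus Z_n^{-1})\eta(U)^T$ (the covariance matrix of the pure Gaussian state obtained by applying the passive Gaussian unitary associated with $\eta(U)$ to a product of single-mode squeezed states), and $M_{n,k}(U)$ is the $2k\times2k$ submatrix of $M_n(U)$ with rows and columns indexed by $\{1,\ldots,k\}\cup\{n+1,\ldots,n+k\}$ (covariance matrix of the reduced state on the first $k$ modes). Symplectic eigenvalues of $M_{n,k}(U)$: numbers $\lambda_j\ge1$ with spectrum of $J_kM_{n,k}(U)$ equal to $\bigcup_j\{\pm i\lambda_j\}$. Bounded squeezing of degree $\zeta$: there is $C>0$ with $\|Z_n\|_\infty\le Cn^\zeta$ for all large $n$. Subsystem sizes $k_n\in\{1,\ldots,n\}$ bounded of degree $\kappa$: there is $K>0$ with $k_n\le Kn^\kappa$ for all large $n$. *)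

(* Defs.v *)
From HB Require Import structures.
From mathcomp Require Import all_boot all_order all_algebra.
From mathcomp Require Import all_classical all_reals all_analysis.
From mathcomp Require Import complex.
Set Implicit Arguments. Unset Strict Implicit. Unset Printing Implicit Defensive.
Import Order.TTheory GRing.Theory Num.Theory.
Local Open Scope ring_scope.
Local Open Scope classical_set_scope.

Section Defs.
Variable R : realType.

(* complex n x n matrices, as a pointed type (needed for sigma-algebras) *)
Definition cmx (n : nat) : Type := 'M[R[i]]_n.
HB.instance Definition _ n := Choice.on (cmx n).
HB.instance Definition _ n := isPointed.Build (cmx n) (0 : 'M[R[i]]_n).

(* Borel sigma-algebra on complex matrices = the one generated by the
   (Borel-measurable) real and imaginary parts of the entries *)
Definition cmx_gen (n : nat) : set (set (cmx n)) :=
  [set A | exists (i j : 'I_n) (B : set R), measurable B /\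
     (A = [set U : cmx n | B (complex.Re ((U : 'M[R[i]]_n) i j))] \/
      A = [set U : cmx n | B (complex.Im ((U : 'M[R[i]]_n) i j))])].

Definition cmx_meas (n : nat) := g_sigma_algebraType (@cmx_gen n).

Definition adjmx n (U : 'M[R[i]]_n) : 'M[R[i]]_n := (map_mx (@conjc R) U)^T.
Definition unitary n (U : 'M[R[i]]_n) : Prop := U *m adjmx U = 1%:M.
Definition unitary_group n : set (cmx_meas n) := [set U | unitary (U : 'M[R[i]]_n)].

(* Haar (probability) measure on U(n), seen as a Borel probability measure on
   complex n x n matrices: concentrated on U(n) and invariant under left
   multiplication by every unitary matrix.  (Such a measure exists and is
   unique: it is the normalized Haar measure of the compact group U(n).) *)
Definition is_Haar n (P : probability (cmx_meas n) R) : Prop :=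
  P (@unitary_group n) = 1%E /\
  forall (V : 'M[R[i]]_n), unitary V ->
    forall A : set (cmx_meas n), measurable A ->
      P [set U : cmx_meas n | A (V *m (U : 'M[R[i]]_n) : cmx_meas n)] = P A.

Definition ReM n (U : 'M[R[i]]_n) : 'M[R]_n := map_mx (@complex.Re R) U.
Definition ImM n (U : 'M[R[i]]_n) : 'M[R]_n := map_mx (@complex.Im R) U.
Definition eta n (U : 'M[R[i]]_n) : 'M[R]_(n + n) :=
  block_mx (ReM U) (ImM U) (- ImM U) (ReM U).

Definition Zdiag n (z : 'I_n -> R) : 'M[R]_n := diag_mx (\row_j z j).
Definition ZZinv n (z : 'I_n -> R) : 'M[R]_(n + n) :=
  block_mx (Zdiag z) 0 0 (diag_mx (\row_j (z j)^-1)).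

Definition Mn n (z : 'I_n -> R) (U : 'M[R[i]]_n) : 'M[R]_(n + n) :=
  eta U *m ZZinv z *m (eta U)^T.

Definition mx_nat m (A : 'M[R]_m) (a b : nat) : R :=
  match insub a, insub b with
  | Some i, Some j => A i j
  | _, _ => 0
  end.

(* 0-based index of the t-th row/column kept: first k rows {0..k-1},
   then {n..n+k-1} (i.e. {1..k} u {n+1..n+k} in 1-based notation) *)
Definition sub_idx (n k : nat) (t : 'I_(k + k)) : nat :=
  if (t < k)%N then nat_of_ord t else (n + (t - k))%N.

(* M_{n,k}(U): covariance matrix of the reduced state on the first k modes *)
Definition Mnk n k (z : 'I_n -> R) (U : 'M[R[i]]_n) : 'M[R]_(k + k) :=
  \matrix_(s, t) mx_nat (Mn z U) (@sub_idx n k s) (@sub_idx n k t).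

Definition Jk k : 'M[R]_(k + k) := block_mx 0 (- 1%:M) 1%:M 0.

(* lam_1..lam_k are the symplectic eigenvalues of M (with multiplicity):
   lam_j >= 1 and the spectrum of J_k M (with multiplicities) is the union of
   the {+- i lam_j}, i.e. char_poly (J_k M) = prod_j (X - i lam_j)(X + i lam_j) *)
Definition symplectic_eigenvalues k (M : 'M[R]_(k + k)) (lam : 'I_k -> R) : Prop :=
  (forall j, 1 <= lam j) /\
  char_poly (map_mx (fun x : R => (x%:C)%C) (Jk k *m M)) =
    \prod_(j < k) (('X - ((0 : R) +i* lam j)%C%:P) * ('X - ((0 : R) -i* lam j)%C%:P)).

Definition avg_energy n (z : 'I_n -> R) : R :=
  (2 * n%:R)^-1 * \sum_(j < n) (z j + (z j)^-1).

Definition deviation_event n k (z : 'I_n -> R) (eps : R) : set (cmx_meas n) :=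
  [set U | exists lam : 'I_k -> R,
     @symplectic_eigenvalues k (@Mnk n k z (U : 'M[R[i]]_n)) lam /\
     eps < \sum_(j < k) ((lam j) ^+ 2 - (avg_energy z) ^+ 2) ^+ 2].

End Defs.

(* Main.v *)
Require Import Defs.
From HB Require Import structures.
From mathcomp Require Import all_boot all_order all_algebra.
From mathcomp Require Import all_classical all_reals all_analysis.
From mathcomp Require Import measurable_realfun complex ring lra.
Import Order.TTheory GRing.Theory Num.Theory.
Import Defs.
Local Open Scope ring_scope.
Local Open Scope classical_set_scope.
Set Implicit Arguments.
Unset Strict Implicit.
Unset Printing Implicit Defensive.

(** Let [D] be the deviation of the reduced covariance matrix [M_k] from
    [lambda 1] and [f = |D|^2] its squared Frobenius norm. The symplectic
    eigenvalues satisfy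
      2 sum_j (lambda_j^2 - lambda^2)^2 = tr ((J M_k)^2 + lambda^2)^2,
    and the right-hand side is at most 16 z_max^2 f and at most
    (8 lambda^2 + 2 f) f, so it suffices to bound the tail of f.
    Concentration of f comes from the invariance of the Haar measure alone:
    expanding E exp (theta f(V U)) = E exp (theta f(U)) to second order along
    one-parameter groups of rotations V and summing over a tight frame of the
    Lie algebra u(n) gives
      E [exp (theta f) (L f + 2 theta |grad f|^2)] >= 0.
    The entries of D are eigenfunctions of the Casimir operator L up to a term
    of the right sign, whence L f <= b - 4 n f, while |grad f|^2 <= 128 z_max^2 f.
    For theta of order n / z_max^2 this becomes E [exp (theta f) (f - a)] <= 0,
    and since
      (f - a) exp (theta f) >= (tau - a) exp (theta tau) 1_{f >= tau} - a exp (theta a)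
    it follows that P (f >= tau) <= exp (- theta tau / 2) for tau >= 2 a. *)

(** * The Frobenius inner product *)

(** Write [F] for the sum to be bounded, half of the trace. For large [f] the linear bound gives
    [F <= 8 z_max^2 f]; with [f <= 8 k z_max^2] this yields [F^2 <= 512 k z_max^6 f]. So [F > eps]
    forces [f >= eps^2 / (512 k z_max^6)], and multiplying by [theta] produces the exponent
    [n eps^2 / (k z_max^8)]. For small [f] the linear bound would cost a factor [z_max^2] in the
    admissible range of [eps]; the quadratic bound does not, and the range is then set by [a], of
    order [k^2 z_max / n]. That only one factor [z_max] occurs there rests on
    [tr (S M^2 S^T) <= z_max tr (S M S^T)]. The Haar measure is known only through its mass on U(n)
    and left invariance, so no calculus on the group is at hand. Derivatives are replaced by exactly
    unitary rotations, polynomial in a generator [X] with [X^3 = - X], with explicit remainders. The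
    event quantifies over the eigenvalues existentially, so its measurability needs an argument of
    its own, by compactness. *)

Section Frobenius.
Variable R : realFieldType.

Definition fdot p q (A B : 'M[R]_(p, q)) : R := \tr (A *m B^T).
Definition fsq p q (A : 'M[R]_(p, q)) : R := fdot A A.

Lemma fdotE p q (A B : 'M[R]_(p, q)) :
  fdot A B = \sum_i \sum_j A i j * B i j.
Proof.
rewrite /fdot /mxtrace; apply: eq_bigr => i _; rewrite mxE.
by apply: eq_bigr => j _; rewrite mxE.
Qed.

Lemma fdotC p q (A B : 'M[R]_(p, q)) : fdot A B = fdot B A.
Proof. by rewrite /fdot -mxtrace_tr trmx_mul trmxK. Qed.

Lemma fdotDl p q (A B C : 'M[R]_(p, q)) : fdot (A + B) C = fdot A C + fdot B C.
Proof. by rewrite /fdot mulmxDl mxtraceD. Qed.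

Lemma fdotDr p q (A B C : 'M[R]_(p, q)) : fdot A (B + C) = fdot A B + fdot A C.
Proof. by rewrite !(fdotC A) fdotDl. Qed.

Lemma fdotZl p q a (A B : 'M[R]_(p, q)) : fdot (a *: A) B = a * fdot A B.
Proof. by rewrite /fdot -scalemxAl mxtraceZ. Qed.

Lemma fdotZr p q a (A B : 'M[R]_(p, q)) : fdot A (a *: B) = a * fdot A B.
Proof. by rewrite !(fdotC A) fdotZl. Qed.

Lemma fdotNl p q (A B : 'M[R]_(p, q)) : fdot (- A) B = - fdot A B.
Proof. by rewrite -scaleN1r fdotZl mulN1r. Qed.

Lemma fdotNr p q (A B : 'M[R]_(p, q)) : fdot A (- B) = - fdot A B.
Proof. by rewrite !(fdotC A) fdotNl. Qed.

Lemma fdot_sumr p q (I : finType) (A : 'M[R]_(p, q)) (B : I -> 'M[R]_(p, q)) :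
  fdot A (\sum_i B i) = \sum_i fdot A (B i).
Proof.
apply: (big_ind2 (fun X x => fdot A X = x)) => //.
  by rewrite /fdot trmx0 mulmx0 mxtrace0.
by move=> X x Y y <- <-; rewrite fdotDr.
Qed.

Lemma fdotT p q (A B : 'M[R]_(p, q)) : fdot A^T B^T = fdot A B.
Proof. by rewrite /fdot trmxK mxtrace_mulC -[LHS]mxtrace_tr trmx_mul trmxK. Qed.

Lemma fdot_mull p q r (C : 'M[R]_(p, q)) (A : 'M[R]_(q, r)) B :
  fdot (C *m A) B = fdot A (C^T *m B).
Proof. by rewrite /fdot trmx_mul trmxK mulmxA -mulmxA mxtrace_mulC. Qed.

Lemma fdot_mulr p q r (C : 'M[R]_(q, r)) (A : 'M[R]_(p, q)) B :
  fdot (A *m C) B = fdot A (B *m C^T).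
Proof. by rewrite /fdot trmx_mul trmxK mulmxA. Qed.

Lemma fsqE p q (A : 'M[R]_(p, q)) : fsq A = \sum_i \sum_j A i j ^+ 2.
Proof. by rewrite /fsq fdotE. Qed.

Lemma fsq_ge0 p q (A : 'M[R]_(p, q)) : 0 <= fsq A.
Proof.
by rewrite fsqE; apply: sumr_ge0 => i _; apply: sumr_ge0 => j _; exact: sqr_ge0.
Qed.

Lemma fsqD p q (A B : 'M[R]_(p, q)) : fsq (A + B) = fsq A + 2 * fdot A B + fsq B.
Proof. rewrite /fsq fdotDl !fdotDr (fdotC B A); ring. Qed.

Lemma fsqZ p q a (A : 'M[R]_(p, q)) : fsq (a *: A) = a ^+ 2 * fsq A.
Proof. by rewrite /fsq fdotZl fdotZr mulrA. Qed.

Lemma fsqN p q (A : 'M[R]_(p, q)) : fsq (- A) = fsq A.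
Proof. by rewrite /fsq fdotNl fdotNr opprK. Qed.

Lemma fsqT p q (A : 'M[R]_(p, q)) : fsq A^T = fsq A.
Proof. exact: fdotT. Qed.

Lemma fsq1 p : fsq (1%:M : 'M[R]_p) = p%:R.
Proof. by rewrite /fsq /fdot trmx1 mulmx1 mxtrace1. Qed.

Lemma fsqD_le p q (A B : 'M[R]_(p, q)) : fsq (A + B) <= 2 * fsq A + 2 * fsq B.
Proof.
have := fsq_ge0 (A - B); rewrite !fsqD fdotNr fsqN; lra.
Qed.

Lemma fdot_le p q (A B : 'M[R]_(p, q)) : 2 * fdot A B <= fsq A + fsq B.
Proof. have := fsq_ge0 (A - B); rewrite fsqD fdotNr fsqN; lra. Qed.

Lemma normr_fdot_le p q (A B : 'M[R]_(p, q)) : `|fdot A B| <= fsq A + fsq B.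
Proof.
have := fdot_le A B; have := fdot_le A (- B); rewrite fdotNr fsqN => h1 h2.
have := fsq_ge0 A; have := fsq_ge0 B; rewrite ler_norml; lra.
Qed.

Lemma fdot_CS p q (A B : 'M[R]_(p, q)) : fdot A B ^+ 2 <= fsq A * fsq B.
Proof.
have := fsq_ge0 B; rewrite le_eqVlt => /predU1P[B0|B_gt0].
  suff -> : fdot A B = 0 by rewrite expr0n /= -B0 mulr0.
  have {}B0 i j : B i j = 0.
    move/esym: B0; rewrite fsqE => /eqP.
    rewrite psumr_eq0; last by move=> *; apply: sumr_ge0 => *; exact: sqr_ge0.
    move/allP => /(_ i (mem_index_enum _)) /=.
    rewrite psumr_eq0; last by move=> *; exact: sqr_ge0.
    by move/allP => /(_ j (mem_index_enum _)) /=; rewrite sqrf_eq0 => /eqP.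
  by rewrite fdotE big1 // => i _; rewrite big1 // => j _; rewrite B0 mulr0.
have := fsq_ge0 (fsq B *: A - fdot A B *: B).
rewrite fsqD fdotNr fsqN !fsqZ fdotZl fdotZr.
rewrite (_ : _ + _ = fsq B * (fsq A * fsq B - fdot A B ^+ 2)); last by ring.
by rewrite pmulr_rge0 // subr_ge0.
Qed.

Lemma fsqM p q r (A : 'M[R]_(p, q)) (B : 'M[R]_(q, r)) :
  fsq (A *m B) <= fsq A * fsq B.
Proof.
have entry i j : (A *m B) i j = fdot (row i A) (col j B)^T.
  rewrite fdotE big_ord1 mxE; apply: eq_bigr => l _; by rewrite !mxE.
have rows : fsq A = \sum_i fsq (row i A).
  rewrite fsqE; apply: eq_bigr => i _; rewrite fsqE big_ord1.
  by apply: eq_bigr => j _; rewrite mxE.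
have cols : fsq B = \sum_j fsq (col j B)^T.
  rewrite fsqE exchange_big /=; apply: eq_bigr => i _; rewrite fsqE big_ord1.
  by apply: eq_bigr => j _; rewrite !mxE.
rewrite fsqE rows mulr_suml; apply: ler_sum => i _.
rewrite cols mulr_sumr; apply: ler_sum => j _.
by rewrite entry fdot_CS.
Qed.

Lemma fsq_coisom_tr p q r (S : 'M[R]_(p, q)) (B : 'M[R]_(p, r)) :
  S *m S^T = 1%:M -> fsq (S^T *m B) = fsq B.
Proof. by move=> h; rewrite /fsq fdot_mull trmxK mulmxA h mul1mx. Qed.

(** The difference of the two sides is the squared norm of [B - S^T S B], the part of [B] killed by
    the projection [S^T S]. *)
Lemma fsq_coisom p q r (S : 'M[R]_(p, q)) (B : 'M[R]_(q, r)) :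
  S *m S^T = 1%:M -> fsq (S *m B) <= fsq B.
Proof.
move=> h; have := fsq_ge0 (B - S^T *m (S *m B)).
rewrite fsqD fdotNr fsqN fsq_coisom_tr // [fdot B _]fdotC fdot_mull trmxK -/(fsq _).
lra.
Qed.

Lemma fsq_diag p r (d : 'rV[R]_p) (B : 'M[R]_(p, r)) (c : R) :
  (forall j, `|d 0 j| <= c) -> fsq (diag_mx d *m B) <= c ^+ 2 * fsq B.
Proof.
move=> dc; rewrite !fsqE mulr_sumr; apply: ler_sum => i _.
rewrite mulr_sumr; apply: ler_sum => j _.
rewrite mul_diag_mx !mxE exprMn ler_wpM2r ?sqr_ge0 //.
by rewrite -real_normK ?num_real // lerXn2r ?nnegrE // (le_trans _ (dc i)).
Qed.

End Frobenius.

(** * The real representation of complex matrices *)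

Section RealRepresentation.
Variable R : realType.

Lemma ReM_mul n (U V : 'M[R[i]]_n) :
  ReM (U *m V) = ReM U *m ReM V - ImM U *m ImM V.
Proof.
apply/matrixP => i j; rewrite !mxE raddf_sum -sumrB; apply: eq_bigr => l _.
by rewrite !mxE; case: (U i l) (V l j) => [a b] [c d].
Qed.

Lemma ImM_mul n (U V : 'M[R[i]]_n) :
  ImM (U *m V) = ReM U *m ImM V + ImM U *m ReM V.
Proof.
apply/matrixP => i j; rewrite !mxE raddf_sum -big_split; apply: eq_bigr => l _.
by rewrite !mxE; case: (U i l) (V l j) => [a b] [c d].
Qed.

Lemma eta_mul n (U V : 'M[R[i]]_n) : eta (U *m V) = eta U *m eta V.
Proof.
unfold eta; rewrite mulmx_block ReM_mul ImM_mul !mulNmx !mulmxN.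
by congr block_mx; rewrite ?opprD 1?[LHS]addrC // addrC.
Qed.

Lemma etaD n (U V : 'M[R[i]]_n) : eta (U + V) = eta U + eta V.
Proof.
have eR : ReM (U + V) = ReM U + ReM V by exact: raddfD.
have eI : ImM (U + V) = ImM U + ImM V by exact: raddfD.
by unfold eta; rewrite add_block_mx eR eI opprD.
Qed.

Lemma etaZ n (a : R) (U : 'M[R[i]]_n) : eta (a%:C%C *: U) = a *: eta U.
Proof.
rewrite /eta scale_block_mx scalerN; congr (block_mx _ _ (- _) _);
  apply/matrixP => i j; rewrite !mxE; case: (U i j) => x y /=; by rewrite mul0r ?subr0 ?addr0.
Qed.

Lemma eta1 n : eta (1%:M : 'M[R[i]]_n) = 1%:M.
Proof.
rewrite /eta; have -> : ReM (1%:M : 'M[R[i]]_n) = 1%:M.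
  by apply/matrixP => i j; rewrite !mxE; case: eqP.
have -> : ImM (1%:M : 'M[R[i]]_n) = 0.
  by apply/matrixP => i j; rewrite !mxE; case: eqP.
by rewrite oppr0 -scalar_mx_block.
Qed.

Lemma eta_adj n (U : 'M[R[i]]_n) : eta (adjmx U) = (eta U)^T.
Proof.
rewrite /eta tr_block_mx; congr block_mx; apply/matrixP => i j;
  rewrite !mxE; by case: (U _ _) => x y //=; rewrite opprK.
Qed.

Lemma eta_inj n : injective (@eta R n).
Proof.
move=> U V /eq_block_mx[/matrixP eR /matrixP eI _ _].
apply/matrixP => i j; move: (eR i j) (eI i j); rewrite !mxE.
by case: (U i j) (V i j) => [a b] [c d] /= -> ->.
Qed.

Lemma unitary_etaP n (U : 'M[R[i]]_n) :
  unitary U <-> eta U *m (eta U)^T = 1%:M.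
Proof.
rewrite -eta_adj -eta_mul -eta1; split => [-> //|]; exact: eta_inj.
Qed.

Lemma unitary_mul n (U V : 'M[R[i]]_n) :
  unitary U -> unitary V -> unitary (U *m V).
Proof.
move=> /unitary_etaP hU /unitary_etaP hV; apply/unitary_etaP.
by rewrite eta_mul trmx_mul -mulmxA (mulmxA (eta V)) hV mul1mx.
Qed.

Definition cplx n (A B : 'M[R]_n) : 'M[R[i]]_n := \matrix_(i, j) (A i j +i* B i j)%C.

Lemma eta_cplx n (A B : 'M[R]_n) : eta (cplx A B) = block_mx A B (- B) A.
Proof. by congr (block_mx _ _ (- _) _); apply/matrixP => i j; rewrite !mxE. Qed.

Lemma Jk_tr n : (Jk R n)^T = - Jk R n.
Proof.
by rewrite /Jk tr_block_mx opp_block_mx !trmx0 raddfN /= trmx1 oppr0 opprK.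
Qed.

Lemma Jk_sqr n : Jk R n *m Jk R n = - 1%:M.
Proof.
rewrite /Jk mulmx_block !mul0mx !mulmx0 mulmxN mulNmx !mulmx1 !add0r !addr0.
by rewrite [in RHS]scalar_mx_block opp_block_mx oppr0.
Qed.

Lemma Jk_coisom n : Jk R n *m (Jk R n)^T = 1%:M.
Proof. by rewrite Jk_tr mulmxN Jk_sqr opprK. Qed.

(** Partial identities on both quadrature blocks: reduction to the first [k] modes becomes
    compression by a coisometry. *)
Definition selmx k n : 'M[R]_(k + k, n + n) :=
  block_mx (pid_mx k) 0 0 (pid_mx k).

Lemma selmx_coisom k n : (k <= n)%N -> selmx k n *m (selmx k n)^T = 1%:M.
Proof.
move=> kn; rewrite /selmx tr_block_mx mulmx_block !trmx0 !mul0mx !mulmx0.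
rewrite !add0r !addr0 !tr_pid_mx !pid_mx_id // pid_mx_1.
by rewrite -scalar_mx_block.
Qed.

(** Whole modes are selected, so the symplectic form is respected; this moves the [J] terms of the
    Casimir identity through the compression. *)
Lemma Jk_selmx k n : Jk R k *m selmx k n = selmx k n *m Jk R n.
Proof.
rewrite /Jk /selmx !mulmx_block !mulNmx !mulmxN !mul0mx !mulmx0 !mul1mx !mulmx1.
by rewrite ?(add0r, addr0, subr0, sub0r, oppr0).
Qed.

Lemma Mnk_sel n k (z : 'I_n -> R) (U : 'M[R[i]]_n) : (k <= n)%N ->
  Mnk k z U = selmx k n *m Mn z U *m (selmx k n)^T.
Proof.
move=> kn.
(* All selected indices are in range, so the default value 0 of [mx_nat] is never taken. *)
have sel_lt (s : 'I_(k + k)) : (sub_idx n s < n + n)%N.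
  rewrite /sub_idx; case: (ltnP s k) => h.
    by apply: (leq_trans h); rewrite (leq_trans kn) ?leq_addr.
  by rewrite ltn_add2l; apply: leq_trans kn; rewrite ltn_subLR.
have selE s t : selmx k n s t = (t == Ordinal (sel_lt s))%:R.
  rewrite -val_eqE /= /sub_idx /selmx.
  case: (splitP s) (splitP t) => [s' es|s' es] [t' et|t' et].
  - rewrite (_ : s = lshift k s'); last exact: val_inj.
    rewrite (_ : t = lshift n t'); last exact: val_inj.
    by rewrite block_mxEul mxE /= ltn_ord andbT eq_sym.
  - rewrite (_ : s = lshift k s'); last exact: val_inj.
    rewrite (_ : t = rshift n t'); last exact: val_inj.
    rewrite block_mxEur mxE /=.
    case: eqP => // e; have := ltn_ord s'; rewrite -e => h.
    by have := leq_trans h kn; rewrite ltnNge leq_addr.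
  - rewrite (_ : s = rshift k s'); last exact: val_inj.
    rewrite (_ : t = lshift n t'); last exact: val_inj.
    rewrite block_mxEdl mxE /= addKn.
    by case: eqP => // e; have := ltn_ord t'; rewrite e ltnNge leq_addr.
  - rewrite (_ : s = rshift k s'); last exact: val_inj.
    rewrite (_ : t = rshift n t'); last exact: val_inj.
    rewrite block_mxEdr mxE /= ltn_ord andbT addKn.
    by rewrite eqn_add2l eq_sym.
apply/matrixP => s t; rewrite [LHS]mxE /mx_nat.
rewrite (insubT (fun x => x < n + n)%N (sel_lt s)) (insubT (fun x => x < n + n)%N (sel_lt t)) /=.
rewrite [RHS]mxE (bigD1 (Ordinal (sel_lt t))) //= big1 ?addr0; last first.
  by move=> j jt; rewrite [(selmx k n)^T _ _]mxE selE (negbTE jt) mulr0.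
rewrite [(selmx k n)^T _ _]mxE selE eqxx mulr1 [RHS]mxE.
rewrite (bigD1 (Ordinal (sel_lt s))) //= big1 ?addr0; last first.
  by move=> j js; rewrite selE (negbTE js) mul0r.
by rewrite selE eqxx mul1r.
Qed.

End RealRepresentation.

(** * The Casimir identities of the unitary Lie algebra *)

Section Casimir.
Variables (R : realType) (n : nat).
Implicit Types (a b c d : 'I_n).

(* [ugen (a, b, true)] and [ugen (a, b, false)] are E_ab - E_ba and
   i (E_ab + E_ba); over all ordered pairs they form a tight frame of u(n). *)
Definition ugen (p : 'I_n * 'I_n * bool) : 'M[R[i]]_n :=
  let: (a, b, c) := p in
  if c then cplx (delta_mx a b - delta_mx b a) 0
       else cplx 0 (delta_mx a b + delta_mx b a).

Let X p := eta (ugen p).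

Lemma ugen_sum (V : nmodType) (F : 'I_n * 'I_n * bool -> V) :
  \sum_p F p = \sum_a \sum_b F (a, b, true) + \sum_a \sum_b F (a, b, false).
Proof.
rewrite !pair_bigA -big_split /=.
rewrite (eq_bigr (fun p : ('I_n * 'I_n) * bool => F (p.1, p.2))); last by case.
rewrite -(pair_bigA _ (fun (q : 'I_n * 'I_n) (c : bool) => F (q, c))) /=.
by apply: eq_bigr => -[a b] _; rewrite big_bool.
Qed.

(** The sign [e] lets the skew ([e = -1]) and symmetric ([e = 1]) generators share one
    computation. *)
Let dl a b (e : R) : 'M[R]_n := delta_mx a b + e *: delta_mx b a.

Lemma etaugenT a b :
  X (a, b, true) = block_mx (dl a b (-1)) 0 0 (dl a b (-1)).
Proof. by rewrite /X /ugen /dl eta_cplx oppr0 scaleN1r. Qed.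

Lemma etaugenF a b :
  X (a, b, false) = block_mx 0 (dl a b 1) (- dl a b 1) 0.
Proof. by rewrite /X /ugen /dl eta_cplx scale1r. Qed.

Lemma dl_tr a b (e : R) : e ^+ 2 = 1 -> (dl a b e)^T = e *: dl a b e.
Proof.
move=> e1; rewrite /dl raddfD /= linearZ /= !trmx_delta scalerDr scalerA -expr2.
by rewrite e1 scale1r addrC.
Qed.

Lemma etaugen_tr p : (X p)^T = - X p.
Proof.
have N1 : (-1) ^+ 2 = 1 :> R by rewrite sqrrN expr1n.
have P1 : 1 ^+ 2 = 1 :> R by rewrite expr1n.
case: p => -[a b] [].
  by rewrite etaugenT tr_block_mx opp_block_mx !trmx0 oppr0 !dl_tr // scaleN1r.
rewrite etaugenF tr_block_mx opp_block_mx !trmx0 oppr0 opprK.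
by rewrite raddfN /= !dl_tr // scale1r.
Qed.

Lemma delta_mulmx_delta (B : 'M[R]_n) a b c d :
  delta_mx a b *m B *m delta_mx c d = B b c *: delta_mx a d :> 'M[R]_n.
Proof.
apply/matrixP => i j; rewrite !mxE (bigD1 c) //= big1 ?addr0; last first.
  by move=> l lc; rewrite [delta_mx _ _ _ _]mxE (negbTE lc) mulr0.
rewrite !mxE eqxx /= (bigD1 b) //= big1 ?addr0; last first.
  by move=> l lb; rewrite [delta_mx _ _ _ _]mxE (negbTE lb) andbF mul0r.
by rewrite !mxE eqxx andbT; case: eqP; case: eqP => //= *; rewrite ?mulr1 ?mul1r ?mul0r ?mulr0.
Qed.

Lemma sum_delta_tr (B : 'M[R]_n) :
  \sum_a \sum_b delta_mx a b *m B *m delta_mx b a = (\tr B)%:M :> 'M[R]_n.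
Proof.
under eq_bigr do under eq_bigr do rewrite delta_mulmx_delta.
under eq_bigr do rewrite -scaler_suml.
rewrite -scaler_sumr -/(\tr B) -scalemx1; congr (_ *: _).
by rewrite [in RHS]mx1_sum_delta.
Qed.

Lemma sum_delta_trmx (B : 'M[R]_n) :
  \sum_a \sum_b delta_mx a b *m B *m delta_mx a b = B^T.
Proof.
under eq_bigr do under eq_bigr do rewrite delta_mulmx_delta.
rewrite [RHS]matrix_sum_delta; apply: eq_bigr => a _; apply: eq_bigr => b _.
by rewrite mxE.
Qed.

Lemma sum_delta_sandwich (B : 'M[R]_n) (e : R) : e ^+ 2 = 1 ->
  \sum_a \sum_b dl a b e *m B *m dl a b e
  = (2 * e * \tr B)%:M + 2 *: B^T.
Proof.
move=> e1.
have expand a b : dl a b e *m B *m dl a b e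
  = (delta_mx a b *m B *m delta_mx a b + delta_mx b a *m B *m delta_mx b a)
   + e *: (delta_mx a b *m B *m delta_mx b a + delta_mx b a *m B *m delta_mx a b).
  rewrite /dl !mulmxDl !mulmxDr -!scalemxAl -!scalemxAr !scalerA -expr2 e1 scale1r scalerDr.
  by rewrite -!addrA; congr (_ + _); rewrite [_ + delta_mx _ _ *m _ *m _]addrC addrCA.
under eq_bigr do under eq_bigr do rewrite expand.
under eq_bigr do rewrite big_split /= -scaler_sumr.
rewrite big_split /= -scaler_sumr.
under eq_bigr do rewrite big_split /=.
under [X in _ + e *: X]eq_bigr do rewrite big_split /=.
rewrite !big_split /= sum_delta_tr sum_delta_trmx.
rewrite [X in B^T + X]exchange_big /= sum_delta_trmx.
rewrite [X in (\tr B)%:M + X]exchange_big /= sum_delta_tr.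
apply/matrixP => i j; rewrite !mxE; case: (i == j); rewrite ?mulr1n ?mulr0n; ring.
Qed.

Lemma sum_block_mx (I J : finType) (F1 F2 F3 F4 : I -> J -> 'M[R]_n) :
  \sum_a \sum_b block_mx (F1 a b) (F2 a b) (F3 a b) (F4 a b) =
  block_mx (\sum_a \sum_b F1 a b) (\sum_a \sum_b F2 a b)
    (\sum_a \sum_b F3 a b) (\sum_a \sum_b F4 a b).
Proof.
have aux (K : finType) (G1 G2 G3 G4 : K -> 'M[R]_n) :
    \sum_b block_mx (G1 b) (G2 b) (G3 b) (G4 b) =
    block_mx (\sum_b G1 b) (\sum_b G2 b) (\sum_b G3 b) (\sum_b G4 b).
  elim: (index_enum K) => [|b r IH]; first by rewrite !big_nil block_mx_const.
  by rewrite !big_cons IH add_block_mx.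
by under eq_bigr do rewrite aux; rewrite aux.
Qed.

(** The traces of the two families add up on the diagonal blocks and cancel off the diagonal. The
    transposes combine, by symmetry of [B], into [B + J B J], twice the part of [B] that
    anticommutes with [J]. *)
Lemma etaugen_sandwich (B : 'M[R]_(n + n)) : B^T = B ->
  \sum_p X p *m B *m (X p)^T
  = (2 * \tr B)%:M - 2 *: (B + Jk R n *m B *m Jk R n).
Proof.
rewrite -[B]submxK; set B1 := ulsubmx B; set B2 := ursubmx B.
set B3 := dlsubmx B; set B4 := drsubmx B.
rewrite tr_block_mx => /eq_block_mx[e1 e3 e2 e4].
have N1 : (-1) ^+ 2 = 1 :> R by rewrite sqrrN expr1n.
have P1 : 1 ^+ 2 = 1 :> R by rewrite expr1n.
have zeros := (mul0mx, mulmx0, add0r, addr0, sub0r, subr0, oppr0).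
have sT a b : X (a, b, true) *m block_mx B1 B2 B3 B4 *m (X (a, b, true))^T =
    - block_mx (dl a b (-1) *m B1 *m dl a b (-1)) (dl a b (-1) *m B2 *m dl a b (-1))
        (dl a b (-1) *m B3 *m dl a b (-1)) (dl a b (-1) *m B4 *m dl a b (-1)).
  by rewrite etaugen_tr etaugenT mulmxN !mulmx_block ?zeros.
have sF a b : X (a, b, false) *m block_mx B1 B2 B3 B4 *m (X (a, b, false))^T =
    block_mx (dl a b 1 *m B4 *m dl a b 1) (- (dl a b 1 *m B3 *m dl a b 1))
        (- (dl a b 1 *m B2 *m dl a b 1)) (dl a b 1 *m B1 *m dl a b 1).
  rewrite etaugen_tr etaugenF mulmxN !mulmx_block ?zeros ?(mulNmx, mulmxN).
  by rewrite ?zeros opp_block_mx !opprK.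
rewrite ugen_sum.
under eq_bigr do (under eq_bigr do rewrite sT; rewrite sumrN).
under [X in _ + X]eq_bigr do under eq_bigr do rewrite sF.
rewrite sumrN !sum_block_mx !(sum_delta_sandwich _ N1).
have sN (A : 'M[R]_n) : \sum_a \sum_b - (dl a b 1 *m A *m dl a b 1) =
    - \sum_a \sum_b dl a b 1 *m A *m dl a b 1.
  by under eq_bigr do rewrite sumrN; rewrite sumrN.
rewrite !sN !(sum_delta_sandwich _ P1) e1 e2 e3 e4.
have t23 : \tr B3 = \tr B2 by rewrite -e2 mxtrace_tr.
rewrite /Jk !mulmx_block ?zeros !mulNmx !mulmxN !mul1mx !mulmx1 mxtrace_block.
rewrite [in RHS]scalar_mx_block ?zeros opp_block_mx !add_block_mx scale_block_mx.
rewrite opp_block_mx !add_block_mx t23.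
congr block_mx; apply/matrixP => i j; rewrite !mxE;
  case: (i == j); rewrite ?mulr1n ?mulr0n; ring.
Qed.

(** The sandwich identity at [B = 1], where [1 + J J = 0] leaves only the trace term. *)
Lemma etaugen_sqr : \sum_p X p *m X p = - (4 * n%:R)%:M.
Proof.
have := @etaugen_sandwich 1%:M (trmx1 _ _).
rewrite mulmx1 Jk_sqr subrr scaler0 subr0 mxtrace1 => h.
under eq_bigr => p _ do
  rewrite -[X p in X in _ *m X]opprK -etaugen_tr mulmxN -[X p in X in X *m _]mulmx1.
rewrite sumrN h; congr (- _%:M); rewrite natrD; ring.
Qed.

(** Each trace is a signed sum of four entries of [K]: Cauchy-Schwarz costs a factor 4, and over
    ordered pairs each entry occurs twice, whence 8. *)
Lemma etaugen_frame (K : 'M[R]_(n + n)) :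
  \sum_p (\tr (X p *m K)) ^+ 2 <= 8 * fsq K.
Proof.
rewrite -[K]submxK; set K1 := ulsubmx K; set K2 := ursubmx K.
set K3 := dlsubmx K; set K4 := drsubmx K.
have zeros := (mul0mx, mulmx0, add0r, addr0, sub0r, subr0, oppr0).
have tr_dl a b e (B : 'M[R]_n) : \tr (dl a b e *m B) = B b a + e * B a b.
  rewrite /dl mulmxDl -scalemxAl mxtraceD mxtraceZ.
  have tr_delta c d : \tr (delta_mx c d *m B) = B d c.
    rewrite /mxtrace (bigD1 c) //= big1 ?addr0.
      rewrite mxE (bigD1 d) //= big1 ?addr0 ?mxE ?eqxx ?mul1r //.
      by move=> l ld; rewrite mxE (negbTE ld) andbF mul0r.
    move=> l lc; rewrite mxE big1 // => m _.
    by rewrite mxE (negbTE lc) mul0r.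
  by rewrite !tr_delta.
have fsq_blk : fsq (block_mx K1 K2 K3 K4) = fsq K1 + fsq K2 + fsq K3 + fsq K4.
  rewrite /fsq /fdot tr_block_mx mulmx_block mxtrace_block !mxtraceD; ring.
have fsq_swap (B : 'M[R]_n) : fsq B = \sum_a \sum_b B b a ^+ 2.
  by rewrite fsqE exchange_big.
rewrite ugen_sum fsq_blk.
have sum4 (A B : 'M[R]_n) :
    \sum_a \sum_b 4 * (A b a ^+ 2 + A a b ^+ 2 + B b a ^+ 2 + B a b ^+ 2) =
    8 * (fsq A + fsq B).
  under eq_bigr do (rewrite -mulr_sumr !big_split /=).
  rewrite -!mulr_sumr !big_split /= -!fsq_swap -!fsqE; ring.
rewrite (_ : _ * _ = 8 * (fsq K1 + fsq K4) + 8 * (fsq K2 + fsq K3)); last by ring.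
rewrite -!sum4.
have sqr4 (p q r s : R) :
    (p + q + r + s) ^+ 2 <= 4 * (p ^+ 2 + q ^+ 2 + r ^+ 2 + s ^+ 2).
  have := (sqr_ge0 (p - q), sqr_ge0 (p - r), sqr_ge0 (p - s),
           sqr_ge0 (q - r), sqr_ge0 (q - s), sqr_ge0 (r - s)).
  by move=> [[[[[]]]]]; nra.
apply: lerD; apply: ler_sum => a _; apply: ler_sum => b _.
  rewrite etaugenT mulmx_block ?zeros mxtrace_block !tr_dl.
  rewrite -[K1 a b ^+ 2]sqrrN -[K4 a b ^+ 2]sqrrN.
  by apply: le_trans (sqr4 _ _ _ _); rewrite le_eqVlt; apply/orP; left; apply/eqP; ring.
rewrite etaugenF mulmx_block ?zeros mxtrace_block mulNmx raddfN /= !tr_dl.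
rewrite -[K2 b a ^+ 2]sqrrN -[K2 a b ^+ 2]sqrrN.
by apply: le_trans (sqr4 _ _ _ _); rewrite le_eqVlt; apply/orP; left; apply/eqP; ring.
Qed.

(* A diagonal generator 2 i E_aa has cube -4 times itself, the others -1 times. *)
Lemma etaugen_cube p : exists2 c : R, 0 < c & exists2 x : 'M[R[i]]_n,
  X p = c *: eta x & eta x *m eta x *m eta x = - eta x.
Proof.
have zeros := (mul0mx, mulmx0, add0r, addr0, sub0r, subr0, oppr0).
case: p => -[a b] c; have [eab|ab] := eqVneq a b; last first.
  exists 1; first exact: ltr01.
  exists (ugen (a, b, c)); first by rewrite scale1r.
  have cub e : dl a b e *m dl a b e *m dl a b e = e *: dl a b e.
    rewrite /dl !(mulmxDl, mulmxDr) -!(scalemxAl, scalemxAr) !mul_delta_mx_cond.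
    rewrite !eqxx (eq_sym b a) (negbTE ab) !mulr0n !mulr1n !mul_delta_mx_cond.
    rewrite !eqxx ?(eq_sym b a) ?(negbTE ab) ?(mulr0n, mulr1n, scaler0, zeros).
    by rewrite scalerDr.
  rewrite -/(X _); case: c.
    rewrite etaugenT !mulmx_block ?zeros !cub opp_block_mx ?zeros.
    by rewrite scaleN1r.
  rewrite etaugenF !mulmx_block ?zeros ?(mulNmx, mulmxN) ?zeros ?opprK cub scale1r.
  by rewrite opp_block_mx ?zeros ?opprK.
case: c; rewrite -{}eab.
  exists 1; first exact: ltr01.
  have X0 : X (a, a, true) = 0.
    by rewrite etaugenT /dl scaleN1r subrr block_mx_const.
  by exists (ugen (a, a, true)); rewrite -?/(X _) X0 ?scaler0 ?mulmx0 ?oppr0.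
exists 2; first exact: ltr0n.
exists (cplx 0 (delta_mx a a)).
  by rewrite etaugenF eta_cplx scale_block_mx /dl scale1r -mulr2n -scaler_nat scalerN ?scaler0.
rewrite eta_cplx !mulmx_block ?zeros ?(mulNmx, mulmxN) ?zeros ?opprK !mul_delta_mx.
by rewrite opp_block_mx ?zeros ?opprK.
Qed.

End Casimir.

(** * Pointwise estimates *)

Lemma tr_diag_sandwich (R : realFieldType) p q (T : 'M[R]_(p, q)) (d : 'rV[R]_q) :
  \tr (T *m diag_mx d *m T^T) = \sum_i \sum_j T i j ^+ 2 * d 0 j.
Proof.
rewrite /mxtrace; apply: eq_bigr => i _; rewrite mxE; apply: eq_bigr => j _.
by rewrite mul_mx_diag !mxE; ring.
Qed.

Lemma sympl_sqrD (R : comNzRingType) p (J D : 'M[R]_p) (l : R) :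
  J *m J = - 1%:M ->
  J *m (D + l%:M) *m (J *m (D + l%:M)) + (l ^+ 2)%:M =
  l *: (J *m D *m J - D) + J *m (D *m (J *m D)).
Proof.
move=> JJ; rewrite mulmxDr mul_mx_scalar mulmxDl !mulmxDr -!scalemxAl -!scalemxAr.
rewrite !mulmxA JJ mulNmx mul1mx.
by apply/matrixP => i j; rewrite !mxE; case: (i == j); rewrite ?mulr0n ?mulr1n; ring.
Qed.

Section Pointwise.
Variables (R : realType) (n k : nat) (z : 'I_n -> R).
Implicit Types (U : 'M[R[i]]_n) (X : 'M[R]_(n + n)).

Let lam := avg_energy z.
Let S := selmx R k n.
Let J := Jk R k.

(* The deviation of the reduced covariance matrix from its Haar average. *)
Definition dev U : 'M[R]_(k + k) := Mnk k z U - (avg_energy z)%:M.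

Definition dev1 U X : 'M[R]_(k + k) :=
  selmx R k n *m (X *m Mn z U - Mn z U *m X) *m (selmx R k n)^T.

Definition dev2 U X : 'M[R]_(k + k) := selmx R k n *m
  (2^-1 *: (X *m X *m Mn z U + Mn z U *m (X *m X)) + X *m Mn z U *m X^T)
  *m (selmx R k n)^T.

(* First and second derivatives of [fsq (dev U)] along [X]: moving [U] by
   1 + s X + s^2 X^2 / 2 turns [dev U] into
   [dev U + s *: dev1 U X + s ^+ 2 *: dev2 U X + O(s^3)]. *)
Definition der1 U X : R := 2 * fdot (dev U) (dev1 U X).
Definition der2 U X : R := 2 * fdot (dev U) (dev2 U X) + fsq (dev1 U X).

Lemma ZZinv_diag : ZZinv z = diag_mx (row_mx (\row_j z j) (\row_j (z j)^-1)).
Proof. by rewrite diag_mx_row. Qed.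

Lemma Mn_tr U : (Mn z U)^T = Mn z U.
Proof. by rewrite /Mn !trmx_mul trmxK ZZinv_diag tr_diag_mx mulmxA. Qed.

Variable zm : R.
Hypothesis kn : (k <= n)%N.
Hypothesis n_gt0 : (0 < n)%N.
Hypothesis z_ge1 : forall j, 1 <= z j.
Hypothesis z_le : forall j, z j <= zm.

Lemma zm_ge1 : 1 <= zm.
Proof. by apply: le_trans (z_ge1 (Ordinal n_gt0)) (z_le _). Qed.

Lemma zinv_bound j : 0 < (z j)^-1 <= 1.
Proof.
have z0 : 0 < z j by apply: lt_le_trans (z_ge1 j).
by rewrite invr_gt0 z0 invf_le1 ?z_ge1.
Qed.

Lemma ZZinv_bound j :
  0 < (row_mx (\row_j z j) (\row_j (z j)^-1)) 0 j <= zm.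
Proof.
have := zm_ge1; case: (split_ordP j) => i -> zm1.
  rewrite row_mxEl mxE.
  by rewrite z_le (lt_le_trans ltr01).
by rewrite row_mxEr mxE; have /andP[-> h] := zinv_bound i; rewrite (le_trans h).
Qed.

Lemma avg_energy_bounds : 1 <= lam <= zm.
Proof.
have n0 : 0 < 2 * n%:R :> R by rewrite mulr_gt0 ?ltr0n.
rewrite /lam /avg_energy mulrC ler_pdivlMr // ler_pdivrMr // mul1r.
have sumc (c : R) : \sum_(j < n) c = c * n%:R.
  by rewrite sumr_const card_ord mulr_natr.
rewrite [2 * _]mulrC [n%:R * 2]mulrC -sumc; apply/andP; split.
  apply: ler_sum => j _; have := z_ge1 j; have /andP[h _] := zinv_bound j.
  have e : z j * (z j)^-1 = 1 by rewrite divff // gt_eqF // (lt_le_trans ltr01).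
  by move=> h1; have := sqr_ge0 (z j - 1); nra.
rewrite mulr_sumr; apply: ler_sum => j _.
have := z_le j; have /andP[_ h] := zinv_bound j; have := zm_ge1; lra.
Qed.

Lemma lam_ge0 : 0 <= lam.
Proof. by have /andP[h _] := avg_energy_bounds; apply: le_trans h. Qed.

Section Unitary.
Variable U : 'M[R[i]]_n.
Hypothesis uU : unitary U.
Let H := eta U.
Let M := Mn z U.
Let D := dev U.
Let f := fsq D.

Let MT : M^T = M.
Proof. exact: Mn_tr. Qed.

Let SS : S *m S^T = 1%:M.
Proof. exact: selmx_coisom. Qed.

Let HH : H *m H^T = 1%:M.
Proof. exact/unitary_etaP. Qed.

Let HtH : H^T *m H = 1%:M.
Proof. exact: mulmx1C. Qed.

Lemma trace_Mn : \tr M = 2 * n%:R * lam.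
Proof.
rewrite /M /Mn mxtrace_mulC mulmxA HtH mul1mx /ZZinv mxtrace_block /Zdiag.
rewrite !mxtrace_diag -big_split /= /lam /avg_energy mulrA divff ?mul1r.
  by apply: eq_bigr => j _; rewrite !mxE.
by rewrite mulf_neq0 ?pnatr_eq0 // -lt0n.
Qed.

Lemma dev_sel : D = S *m (M - lam%:M) *m S^T.
Proof.
rewrite /D /dev Mnk_sel // mulmxBr mulmxBl -/lam -/S.
by congr (_ - _); rewrite mul_mx_scalar -scalemxAl SS scalemx1.
Qed.

Lemma dev_tr : D^T = D.
Proof.
by rewrite dev_sel !trmx_mul trmxK mulmxA raddfB /= Mn_tr tr_scalar_mx.
Qed.

(** An operator norm bound in Frobenius terms: [M] is [diag(Z, Z^-1)] conjugated by an orthogonal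
    matrix, with entries in (0, [zm]]. *)
Lemma Mn_opbound q (B : 'M[R]_(n + n, q)) : fsq (M *m B) <= zm ^+ 2 * fsq B.
Proof.
rewrite /M /Mn -!mulmxA; apply: le_trans (fsq_coisom _ HH) _; rewrite ZZinv_diag.
rewrite -[in leRHS](fsq_coisom_tr B HH); apply: fsq_diag => j.
by have /andP[h1 h2] := ZZinv_bound j; rewrite ger0_norm // ltW.
Qed.

Lemma Mnk_opbound q (B : 'M[R]_(k + k, q)) : fsq (Mnk k z U *m B) <= zm ^+ 2 * fsq B.
Proof.
rewrite Mnk_sel // -/S -/M -(mulmxA (S *m M)) -(mulmxA S).
apply: le_trans (fsq_coisom _ SS) _.
by apply: le_trans (Mn_opbound _) _; rewrite fsq_coisom_tr.
Qed.

Lemma dev_opbound q (B : 'M[R]_(k + k, q)) : fsq (D *m B) <= 4 * zm ^+ 2 * fsq B.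
Proof.
rewrite /D /dev mulmxBl (le_trans (fsqD_le _ _)) // fsqN mul_scalar_mx fsqZ.
have := Mnk_opbound B; have := fsq_ge0 B.
have /andP[h1 h2] := avg_energy_bounds; rewrite -/lam => B0 h.
have : lam ^+ 2 <= zm ^+ 2 by rewrite lerXn2r // nnegrE ?lam_ge0 // (le_trans lam_ge0).
nra.
Qed.

Lemma fsq_dev_le : f <= 8 * k%:R * zm ^+ 2.
Proof.
have := dev_opbound 1%:M; rewrite mulmx1 fsq1 natrD -/f; lra.
Qed.

Let JJ : J *m J = - 1%:M. Proof. exact: Jk_sqr. Qed.
Let JS : J *m S = S *m Jk R n. Proof. exact: Jk_selmx. Qed.
Let JSt : S^T *m J = Jk R n *m S^T.
Proof.
have := congr1 trmx JS; rewrite !trmx_mul !Jk_tr mulmxN mulNmx => /oppr_inj.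
by [].
Qed.

Let fsqJ q (B : 'M[R]_(k + k, q)) : fsq (J *m B) = fsq B.
Proof.
have := fsq_coisom_tr B (Jk_coisom R k); by rewrite Jk_tr mulNmx fsqN.
Qed.

Let fsqrJ q (B : 'M[R]_(q, k + k)) : fsq (B *m J) = fsq B.
Proof. by rewrite -fsqT trmx_mul Jk_tr mulNmx fsqN fsqJ fsqT. Qed.

Definition sympl_sqr_dev : 'M[R]_(k + k) :=
  J *m Mnk k z U *m (J *m Mnk k z U) + (lam ^+ 2)%:M.

Lemma sympl_sqr_devE :
  sympl_sqr_dev = lam *: (J *m D *m J - D) + J *m (D *m (J *m D)).
Proof.
by rewrite -sympl_sqrD //; rewrite /sympl_sqr_dev /D /dev subrK.
Qed.

(** The constant [c] is left open because the quadratic term [D J D] is estimated in two ways: by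
    submultiplicativity ([c = f]) and by the operator norm of [D] ([c = 4 zm^2]). *)
Lemma tr_sympl_sqr_dev_le (c : R) :
  fsq (D *m (J *m D)) <= c * f ->
  \tr (sympl_sqr_dev *m sympl_sqr_dev) <= (8 * lam ^+ 2 + 2 * c) * f.
Proof.
move=> hc; rewrite (_ : \tr _ = fdot sympl_sqr_dev sympl_sqr_dev^T); last first.
  by rewrite /fdot trmxK.
have h1 := fdot_le sympl_sqr_dev sympl_sqr_dev^T; rewrite fsqT in h1.
have h2 : fsq sympl_sqr_dev <= 2 * (4 * lam ^+ 2 * f) + 2 * (c * f).
  rewrite sympl_sqr_devE (le_trans (fsqD_le _ _)) // lerD // ler_pM2l //; last by rewrite fsqJ.
  rewrite fsqZ (_ : 4 * lam ^+ 2 * f = lam ^+ 2 * (4 * f)); last by ring.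
  rewrite ler_wpM2l ?sqr_ge0 //.
  rewrite (le_trans (fsqD_le _ _)) // fsqN fsqrJ fsqJ -/f; lra.
lra.
Qed.

Lemma tr_sympl_sqr_dev_quad :
  \tr (sympl_sqr_dev *m sympl_sqr_dev) <= (8 * lam ^+ 2 + 2 * f) * f.
Proof. by apply: tr_sympl_sqr_dev_le; rewrite (le_trans (fsqM _ _)) // fsqJ. Qed.

Lemma tr_sympl_sqr_dev_lin :
  \tr (sympl_sqr_dev *m sympl_sqr_dev) <= 16 * zm ^+ 2 * f.
Proof.
have h := dev_opbound (J *m D); rewrite fsqJ -/f in h.
rewrite (le_trans (tr_sympl_sqr_dev_le h)) // ler_wpM2r ?fsq_ge0 //.
have /andP[_ h2] := avg_energy_bounds.
have : lam ^+ 2 <= zm ^+ 2 by rewrite lerXn2r // nnegrE ?lam_ge0 // (le_trans lam_ge0).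
lra.
Qed.

Let X (p : 'I_n * 'I_n * bool) := eta (ugen R p).

(** Since [tr M = 2 n lambda] and scalars commute with [J], the generators sum to
    [- 4 n D - 2 (D + J D J)]. The extra term has the right sign: [fdot D (D + J D J)] is half of
    [fsq (D + J D J)]. *)
Lemma sum_dev2 : \sum_p 2 * fdot D (dev2 U (X p)) <= - (8 * n%:R * f).
Proof.
have sum2 : \sum_p dev2 U (X p) = - (4 * n%:R) *: D - 2 *: (D + J *m D *m J).
  rewrite /dev2 -mulmx_suml -mulmx_sumr big_split /= -scaler_sumr.
  rewrite big_split /= -mulmx_suml -mulmx_sumr etaugen_sqr etaugen_sandwich ?Mn_tr //.
  rewrite -/M trace_Mn -/S dev_sel.
  have -> : J *m (S *m (M - lam%:M) *m S^T) *m J =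
            S *m (Jk R n *m (M - lam%:M) *m Jk R n) *m S^T.
    by rewrite !mulmxA JS -!mulmxA JSt.
  rewrite !mulmxBr !mulmxBl !mul_mx_scalar -!scalemxAl Jk_sqr.
  rewrite !mulNmx !mulmxN !mul_scalar_mx !mul_mx_scalar.
  rewrite !(mulmxDr, mulmxBr, mulmxDl, mulmxBl, mulmxN, mulNmx) -!(scalemxAl, scalemxAr).
  rewrite !(mulmxDr, mulmxBr, mulmxDl, mulmxBl, mulmxN, mulNmx) -!(scalemxAl, scalemxAr).
  rewrite !mulmx1 mul_mx_scalar -scalemxAl SS.
  by apply/matrixP => i j; rewrite !mxE; field.
rewrite -mulr_sumr -fdot_sumr sum2 (fdotDr D (_ *: D)).
rewrite (fdotNr D (2 *: _)) !(fdotZr _ D) (fdotDr D D) -/(fsq D) -/f.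
have := fsq_ge0 (D + J *m D *m J); rewrite (fsqD D) fsqrJ fsqJ -/f; lra.
Qed.

(** The left side is [tr (S M^2 S^T)]. In the eigenbasis of [M] it is a nonnegative combination of
    squared eigenvalues, and [d^2 <= zm d] costs a single factor [zm]. *)
Lemma tr_Mn_sqr_le : fsq (M *m S^T) <= zm * (2 * k%:R * lam + \tr D).
Proof.
have -> : fsq (M *m S^T) = \tr (S *m H *m (ZZinv z *m ZZinv z) *m (S *m H)^T).
  rewrite /fsq /fdot mxtrace_mulC trmx_mul trmxK MT /M /Mn trmx_mul !mulmxA.
  by rewrite -[in LHS](mulmxA _ H^T H) HtH mulmx1.
have -> : 2 * k%:R * lam + \tr D = \tr (S *m H *m ZZinv z *m (S *m H)^T).
  rewrite trmx_mul !mulmxA -[in RHS](mulmxA S) -[in RHS](mulmxA S) -/(Mn z U).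
  rewrite -Mnk_sel //.
  have -> : \tr D = \tr (Mnk k z U) - lam *+ (k + k).
    by rewrite /D /dev raddfB /= mxtrace_scalar.
  rewrite mulrnDr -[lam *+ k]mulr_natr; ring.
rewrite ZZinv_diag mulmx_diag !tr_diag_sandwich mulr_sumr; apply: ler_sum => i _.
rewrite mulr_sumr; apply: ler_sum => j _; rewrite [X in _ * X <= _]mxE [leRHS]mulrCA ler_wpM2l ?sqr_ge0 //.
have /andP[h1 h2] := ZZinv_bound j; rewrite -expr2 expr2 ler_wpM2r //; exact: ltW.
Qed.

(** As [X] is skew, the commutator is [X M] plus its transpose, which costs a factor 4. The Casimir
    identity for [B = M S^T S M] then leaves [4 k tr B]: the traces of [B] and [J B J] after
    compression cancel. *)
Lemma sum_fsq_dev1 :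
  \sum_p fsq (dev1 U (X p)) <= 16 * k%:R * zm * (2 * k%:R * lam + \tr D).
Proof.
pose A p := S *m (X p *m M) *m S^T.
have le4 p : fsq (dev1 U (X p)) <= 4 * fsq (A p).
  have -> : dev1 U (X p) = A p + (A p)^T.
    rewrite /A 3!trmx_mul trmxK MT etaugen_tr !(mulmxN, mulNmx) !mulmxA.
    by rewrite /dev1 mulmxBr mulmxBl !mulmxA.
  by rewrite (le_trans (fsqD_le _ _)) // fsqT; lra.
pose B := M *m S^T *m S *m M.
have BT : B^T = B.
  have gen m l (M' : 'M[R]_m) (S' : 'M[R]_(l, m)) : M'^T = M' ->
      (M' *m S'^T *m S' *m M')^T = M' *m S'^T *m S' *m M'.
    by move=> M'T; rewrite !trmx_mul trmxK M'T !mulmxA.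
  exact: gen.
have fA p : fsq (A p) = \tr (S *m (X p *m B *m (X p)^T) *m S^T).
  have gen m l (M' X' : 'M[R]_m) (S' : 'M[R]_(l, m)) : M'^T = M' ->
      fsq (S' *m (X' *m M') *m S'^T) =
      \tr (S' *m (X' *m (M' *m S'^T *m S' *m M') *m X'^T) *m S'^T).
    by move=> M'T; rewrite /fsq /fdot !trmx_mul trmxK M'T !mulmxA.
  exact: gen.
have trB : \tr B = fsq (M *m S^T).
  by rewrite /fsq /fdot (trmx_mul M) trmxK MT (mulmxA (M *m S^T)).
have sA : \sum_p fsq (A p) = 4 * k%:R * \tr B.
  under eq_bigr do rewrite fA.
  rewrite -raddf_sum -mulmx_suml -mulmx_sumr etaugen_sandwich //.
  rewrite mulmxBr mulmxBl mul_mx_scalar -scalemxAl SS -scalemxAr -scalemxAl.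
  rewrite mulmxDr mulmxDl raddfB /= !mxtraceZ mxtraceD mxtrace1.
  have -> : \tr (S *m (Jk R n *m B *m Jk R n) *m S^T) = - \tr (S *m B *m S^T).
    rewrite !mulmxA -JS -!mulmxA -JSt !mulmxA mxtrace_mulC !mulmxA JJ.
    by rewrite !mulNmx mul1mx raddfN.
  rewrite natrD; ring.
apply: (@le_trans _ _ (\sum_p 4 * fsq (A p))); first exact: ler_sum.
rewrite -mulr_sumr sA trB.
have := tr_Mn_sqr_le; have : 0 <= k%:R :> R by [].
nra.
Qed.

(** By cyclicity the derivative is [2 tr (X K)] with [K] the commutator of [M] and the lifted
    deviation [G]. The constant is 4 from the square, 8 from the frame, 4 from [fsq K]. *)
Lemma sum_der1_sqr : \sum_p der1 U (X p) ^+ 2 <= 128 * zm ^+ 2 * f.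
Proof.
pose G := S^T *m D *m S.
have GT : G^T = G by rewrite /G !trmx_mul trmxK dev_tr !mulmxA.
have fG : fsq G = f.
  rewrite /G -mulmxA fsq_coisom_tr // -fsqT trmx_mul fsq_coisom_tr // dev_tr.
  by [].
pose K := M *m G - G *m M.
have d1 p : der1 U (X p) = 2 * \tr (X p *m K).
  rewrite /der1 -/D /dev1 fdotC fdot_mulr trmxK fdot_mull mulmxA -/G -/S.
  rewrite fdotDl fdotNl fdot_mulr fdot_mull Mn_tr -/M -fdotNr -fdotDr.
  by rewrite /fdot; congr (2 * \tr (_ *m _)); rewrite raddfB /= (trmx_mul G) (trmx_mul M) GT MT.
under eq_bigr do rewrite d1 exprMn.
rewrite -mulr_sumr.
have h := etaugen_frame K.
have fK : fsq K <= 4 * (zm ^+ 2 * f).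
  rewrite (le_trans (fsqD_le _ _)) // fsqN -[fsq (G *m M)]fsqT trmx_mul GT MT.
  have := Mn_opbound G; rewrite fG -/M; lra.
rewrite -/X in h; lra.
Qed.

(** Budget in units of [n f]: the Casimir term gives -8, the trace of [D] in the second-order term
    uses 4, the gradient term uses 2, and -2 remains. *)
Lemma sum_derivatives_le (th : R) : 0 <= th -> th <= n%:R / (64 * zm ^+ 2) ->
  \sum_p (der2 U (X p) + th * der1 U (X p) ^+ 2) <=
  32 * k%:R ^+ 2 * lam * zm + 32 * k%:R ^+ 3 * zm ^+ 2 / n%:R - 2 * n%:R * f.
Proof.
move=> th0 thn.
have -> : \sum_p (der2 U (X p) + th * der1 U (X p) ^+ 2) =
    \sum_p 2 * fdot D (dev2 U (X p)) + \sum_p fsq (dev1 U (X p)) +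
    th * \sum_p der1 U (X p) ^+ 2.
  by rewrite mulr_sumr -!big_split.
have n0 : 0 < n%:R :> R by rewrite ltr0n.
have zm0 : 0 < zm by apply: lt_le_trans zm_ge1.
have h1 := sum_dev2; have h2 := sum_fsq_dev1; have h3 := sum_der1_sqr.
have f0 : 0 <= f := fsq_ge0 _.
have h4 : th * \sum_p der1 U (X p) ^+ 2 <= 2 * n%:R * f.
  apply: le_trans (ler_wpM2l th0 h3) _.
  rewrite ler_pdivlMr in thn; last by rewrite mulr_gt0 ?exprn_gt0.
  by have := ler_wpM2r f0 thn; lra.
(* The linear term in [tr D] is absorbed by completing the square: the Frobenius norm of
   [n D - 2 k zm] is nonnegative. *)
have h5 : 16 * k%:R * zm * \tr D <= 4 * n%:R * f + 32 * k%:R ^+ 3 * zm ^+ 2 / n%:R.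
  have := fsq_ge0 (n%:R *: D - (2 * k%:R * zm)%:M).
  rewrite fsqD fdotNr fsqN !fsqZ -scalemx1 fdotZl fdotZr fsqZ fsq1 natrD.
  rewrite /fdot trmx1 mulmx1 -/f => h.
  rewrite -subr_ge0; set v := (X in 0 <= X).
  have -> : v = 4 / n%:R * (n%:R ^+ 2 * f + 2 * - (n%:R * (2 * k%:R * zm * \tr D)) +
     (2 * k%:R * zm) ^+ 2 * (k%:R + k%:R)).
    rewrite /v; field; exact: lt0r_neq0.
  by rewrite mulr_ge0 // divr_ge0 // ltW.
lra.
Qed.

End Unitary.
End Pointwise.

(** * Symplectic eigenvalues and traces *)

Lemma poly_eq_horner (F : numDomainType) (p q : {poly F}) :
  (forall x, p.[x] = q.[x]) -> p = q.
Proof.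
move=> pq; apply/eqP; rewrite -subr_eq0; apply/eqP.
apply: (@roots_geq_poly_eq0 _ _ [seq i%:R | i <- iota 0 (size (p - q))]).
- by apply/allP => x _; rewrite rootE hornerD hornerN pq subrr.
- by rewrite map_inj_uniq ?iota_uniq // => i j /eqP; rewrite eqr_nat => /eqP.
- by rewrite size_map size_iota.
Qed.

Lemma horner_char_poly_det (F : comNzRingType) m (A : 'M[F]_m) x :
  (char_poly A).[x] = \det (x%:M - A).
Proof.
rewrite /char_poly -horner_evalE -det_map_mx; congr (\det _).
apply/matrixP => i j; rewrite !mxE /= /horner_eval !hornerE hornerMn hornerX.
by [].
Qed.

(** Over a closed field every point is a square [x^2], and [det (x^2 - A^2) = det (x - A) det (x +
    A)]. *)
Lemma char_poly_sqr (F : numClosedFieldType) m (A : 'M[F]_m) (s : seq F) :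
  char_poly A = \prod_(a <- s) ('X - a%:P) ->
  char_poly (A *m A) = \prod_(a <- [seq a ^+ 2 | a <- s]) ('X - a%:P).
Proof.
move=> hA; have ss : size s = m.
  by have := size_char_poly A; rewrite hA size_prod_XsubC => -[].
apply: poly_eq_horner => y; pose x := sqrtC y; have xy : x ^+ 2 = y := sqrtCK y.
have -> : (char_poly (A *m A)).[y] = (char_poly A).[x] * ((-1) ^+ m * (char_poly A).[- x]).
  rewrite !horner_char_poly_det -detZ -det_mulmx; congr (\det _).
  rewrite scaleN1r opprB mulmxBl !mulmxBr !mul_scalar_mx mul_mx_scalar -xy.
  apply/matrixP => i j; rewrite !mxE; case: (i == j); rewrite ?mulr1n ?mulr0n; ring.
rewrite hA big_map !horner_prod -ss.
have -> : (-1) ^+ size s = \prod_(a <- s) (-1 : F).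
  by rewrite big_const_seq count_predT iter_mulr_1.
rewrite -!big_split /=; apply: eq_bigr => a _; rewrite !hornerXsubC -xy.
move: x {xy} => x; ring.
Qed.

Lemma char_poly_shift (F : numDomainType) m (A : 'M[F]_m) (s : seq F) c :
  char_poly A = \prod_(a <- s) ('X - a%:P) ->
  char_poly (A + c%:M) = \prod_(a <- [seq a + c | a <- s]) ('X - a%:P).
Proof.
move=> hA; apply: poly_eq_horner => y.
have e : y%:M - (A + c%:M) = (y - c)%:M - A by rewrite raddfB /= opprD addrAC addrA.
rewrite horner_char_poly_det e.
rewrite -horner_char_poly_det hA big_map !horner_prod; apply: eq_bigr => a _.
rewrite !hornerE; ring.
Qed.

Lemma trace_char_poly (F : comNzRingType) m (A : 'M[F]_m) (s : seq F) :
  char_poly A = \prod_(a <- s) ('X - a%:P) -> \tr A = \sum_(a <- s) a.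
Proof.
move=> hA; have ss : size s = m.
  by have := size_char_poly A; rewrite hA size_prod_XsubC => -[].
(* The coefficient formula for the trace requires a matrix of positive size. *)
have [m0|m0] := posnP m.
  move: ss A {hA}; rewrite m0 => /size0nil -> A.
  by rewrite big_nil /mxtrace big_ord0.
apply: oppr_inj; rewrite -char_poly_trace // hA -{1}ss coefPn_prod_XsubC //.
by rewrite ss -lt0n.
Qed.

(** Squaring [J M] merges [i lambda_j] and [- i lambda_j] into a double eigenvalue [- lambda_j^2];
    the shift by [l^2] and a second square give each summand twice. *)
Lemma symplectic_sum_trace (R : realType) k (M : 'M[R]_(k + k)) (la : 'I_k -> R) l :
  symplectic_eigenvalues M la ->
  let Y := Jk R k *m M *m (Jk R k *m M) + (l ^+ 2)%:M in
  2 * \sum_(j < k) (la j ^+ 2 - l ^+ 2) ^+ 2 = \tr (Y *m Y).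
Proof.
move=> [_ hc] Y; set N := Jk R k *m M in hc Y *.
pose s := [seq ((0 : R) +i* la j)%C | j <- index_enum 'I_k] ++
          [seq ((0 : R) -i* la j)%C | j <- index_enum 'I_k].
have {}hc : char_poly (map_mx (real_complex R) N) = \prod_(a <- s) ('X - a%:P).
  by rewrite [LHS]hc big_split /= /s big_cat !big_map.
have h := trace_char_poly (char_poly_sqr (char_poly_shift ((l ^+ 2)%:C)%C (char_poly_sqr hc))).
apply: (@complexI R).
rewrite -trace_map_mx map_mxM raddfD /= map_mxM map_scalar_mx /= h !big_map.
rewrite /s big_cat !big_map /= -big_split /= rmorphM rmorph_sum /= rmorph_nat.
rewrite mulr_sumr; apply: eq_bigr => j _; rewrite mulrDl.
have sq (x : R) : ((0 : R) +i* x)%C ^+ 2 = - ((x ^+ 2)%:C)%C.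
  by apply/eqP; rewrite expr2 eq_complex /= !(mul0r, mulr0, add0r, addr0, oppr0) !eqxx.
rewrite !sq sqrrN !mul1r rmorphXn /= rmorphB /=; ring.
Qed.

(** * Bounded measurable functions on the unitary group *)

Section BoundedMeasurable.
Variables (R : realType) (n : nat).
Implicit Types (g h : cmx_meas R n -> R).

Definition meas g := measurable_fun [set: cmx_meas R n] g.
(** Measurability is global but the bound is asked on U(n) only: [P] lives on all complex matrices,
    where the entries are unbounded. *)
Definition bddmeas g := meas g /\ exists K : R, forall U, unitary U -> `|g U| <= K.

Lemma meas_Re i j : meas (fun U => complex.Re ((U : 'M[R[i]]_n) i j)).
Proof.
move=> _ B mB; rewrite setTI; apply: sub_sigma_algebra.
by exists i, j, B; split => //; left.
Qed.

Lemma meas_Im i j : meas (fun U => complex.Im ((U : 'M[R[i]]_n) i j)).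
Proof.
move=> _ B mB; rewrite setTI; apply: sub_sigma_algebra.
by exists i, j, B; split => //; right.
Qed.

Lemma measN g : meas g -> meas (fun U => - g U).
Proof.
move=> mg; have := measurable_funM (@measurable_cst _ _ _ _ setT (-1 : R)) mg.
by under [X in measurable_fun _ X]eq_fun do rewrite /= mulN1r.
Qed.

Lemma meas_eta i j : meas (fun U => eta (U : 'M[R[i]]_n) i j).
Proof.
case: (split_ordP i) => i' ->; case: (split_ordP j) => j' ->;
  rewrite /eta; [under eq_fun do rewrite block_mxEul|under eq_fun do rewrite block_mxEur
    |under eq_fun do rewrite block_mxEdl|under eq_fun do rewrite block_mxEdr];
  under eq_fun do rewrite ?mxE; [exact: meas_Re|exact: meas_Im| |exact: meas_Re].
exact: measN (meas_Im i' j').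
Qed.

Lemma bddmeas_cst c : bddmeas (fun=> c).
Proof. by split; [exact: measurable_cst|exists `|c|]. Qed.

Lemma bddmeasD g h : bddmeas g -> bddmeas h -> bddmeas (fun U => g U + h U).
Proof.
move=> [mg [K hK]] [mh [L hL]]; split; first exact: measurable_funD.
by exists (K + L) => U uU; rewrite (le_trans (ler_normD _ _)) // lerD ?hK ?hL.
Qed.

Lemma bddmeasM g h : bddmeas g -> bddmeas h -> bddmeas (fun U => g U * h U).
Proof.
move=> [mg [K hK]] [mh [L hL]]; split; first exact: measurable_funM.
by exists (K * L) => U uU; rewrite normrM ler_pM ?hK ?hL.
Qed.

Lemma bddmeasZ c g : bddmeas g -> bddmeas (fun U => c * g U).
Proof. exact: bddmeasM (bddmeas_cst c). Qed.

Lemma bddmeasN g : bddmeas g -> bddmeas (fun U => - g U).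
Proof.
move=> hg; have := bddmeasM (bddmeas_cst (-1)) hg.
by under eq_fun do rewrite mulN1r.
Qed.

Lemma bddmeas_sum (I : Type) (s : seq I) (F : I -> cmx_meas R n -> R) :
  (forall i, bddmeas (F i)) -> bddmeas (fun U => \sum_(i <- s) F i U).
Proof.
move=> hF; elim: s => [|i s IH].
  by under eq_fun do rewrite big_nil; exact: bddmeas_cst.
by under eq_fun do rewrite big_cons; exact: bddmeasD.
Qed.

Lemma bddmeas_expR g : bddmeas g -> bddmeas (fun U => expR (g U)).
Proof.
move=> [mg [K hK]]; split; first exact: measurableT_comp.
exists (expR K) => U uU; rewrite ger0_norm ?expR_ge0 // ler_expR.
by rewrite (le_trans (ler_norm _)) ?hK.
Qed.

Definition bddmeas_mx p q (F : cmx_meas R n -> 'M[R]_(p, q)) :=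
  forall i j, bddmeas (fun U => F U i j).

Lemma bddmeas_mx_cst p q (A : 'M[R]_(p, q)) : bddmeas_mx (fun=> A).
Proof. by move=> i j; exact: bddmeas_cst. Qed.

Lemma bddmeas_mxD p q (F G : cmx_meas R n -> 'M[R]_(p, q)) :
  bddmeas_mx F -> bddmeas_mx G -> bddmeas_mx (fun U => F U + G U).
Proof. by move=> hF hG i j; under eq_fun do rewrite mxE; exact: bddmeasD. Qed.

Lemma bddmeas_mxN p q (F : cmx_meas R n -> 'M[R]_(p, q)) :
  bddmeas_mx F -> bddmeas_mx (fun U => - F U).
Proof. by move=> hF i j; under eq_fun do rewrite mxE; exact: bddmeasN. Qed.

Lemma bddmeas_mxZ p q c (F : cmx_meas R n -> 'M[R]_(p, q)) :
  bddmeas_mx F -> bddmeas_mx (fun U => c *: F U).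
Proof.
move=> hF i j; under eq_fun do rewrite mxE.
by apply: bddmeasM => //; exact: bddmeas_cst.
Qed.

Lemma bddmeas_mxT p q (F : cmx_meas R n -> 'M[R]_(p, q)) :
  bddmeas_mx F -> bddmeas_mx (fun U => (F U)^T).
Proof. by move=> hF i j; under eq_fun do rewrite mxE. Qed.

Lemma bddmeas_mxM p q r (F : cmx_meas R n -> 'M[R]_(p, q))
    (G : cmx_meas R n -> 'M[R]_(q, r)) :
  bddmeas_mx F -> bddmeas_mx G -> bddmeas_mx (fun U => F U *m G U).
Proof.
move=> hF hG i j; under eq_fun do rewrite mxE.
by apply: bddmeas_sum => l; exact: bddmeasM.
Qed.

Lemma bddmeas_fdot p q (F G : cmx_meas R n -> 'M[R]_(p, q)) :
  bddmeas_mx F -> bddmeas_mx G -> bddmeas (fun U => fdot (F U) (G U)).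
Proof.
move=> hF hG; under eq_fun do rewrite fdotE.
by apply: bddmeas_sum => i; apply: bddmeas_sum => j; exact: bddmeasM.
Qed.

Lemma measurable_unitary_group : measurable (@unitary_group R n).
Proof.
pose g i j := fun U : cmx_meas R n => \sum_l eta (U : 'M[R[i]]_n) i l * eta (U : 'M[R[i]]_n) j l.
have mg i j : meas (g i j).
  by apply: measurable_sum => l; apply: measurable_funM; exact: meas_eta.
have -> : @unitary_group R n =
    \bigcap_(p in [set: 'I_(n + n) * 'I_(n + n)])
      (g p.1 p.2 @^-1` [set (1%:M : 'M[R]_(n + n)) p.1 p.2]).
  apply/seteqP; split => U /=.
    move=> /unitary_etaP hU [i j] _ /=; rewrite -hU mxE.
    by apply: eq_bigr => l _; rewrite [(eta U)^T _ _]mxE.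
  move=> hU; apply/unitary_etaP; apply/matrixP => i j; rewrite -(hU (i, j) I) mxE.
  by apply: eq_bigr => l _; rewrite [(eta U)^T _ _]mxE.
apply: fin_bigcap_measurable => //=.
move=> [i j] _ /=; rewrite -[X in measurable X]setTI; apply: mg => //.
Qed.

Lemma bddmeas_eta : bddmeas_mx (fun U => eta (U : 'M[R[i]]_n)).
Proof.
move=> i j; split; first exact: meas_eta.
exists 1 => U /unitary_etaP hU.
have := congr1 (fun A : 'M[R]_(n + n) => A i i) hU.
rewrite [LHS]mxE [RHS]mxE eqxx mulr1n (bigD1 j) //= [_^T _ _]mxE -expr2 => h.
rewrite -(@ler_pXn2r _ 2) ?nnegrE // expr1n real_normK ?num_real // -h lerDl sumr_ge0 // => l _.
by rewrite [(eta U)^T _ _]mxE -expr2 sqr_ge0.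
Qed.

End BoundedMeasurable.

(** * Expectation over U(n) and its left invariance *)

Section Expectation.
Variables (R : realType) (n : nat) (P : probability (cmx_meas R n) R).
Hypothesis haarP : is_Haar P.
Implicit Types (g h : cmx_meas R n -> R).
Let D : set (cmx_meas R n) := @unitary_group R n.

Definition EE g : R := \int[P]_(U in @unitary_group R n) g U.

Let mD : measurable D. Proof. exact: measurable_unitary_group. Qed.

Lemma bddmeas_integrable g : bddmeas g -> P.-integrable D (EFin \o g).
Proof.
move=> [mg [K hK]]; apply: measurable_bounded_integrable => //.
- by rewrite (le_lt_trans (probability_le1 _ _)) // ltry.
- exact: measurable_funTS.
- exists K; split; first exact: num_real.
  by move=> x Kx U uU /=; rewrite (le_trans (hK U uU)) // ltW.
Qed.

Lemma EED g h : bddmeas g -> bddmeas h -> EE (fun U => g U + h U) = EE g + EE h.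
Proof. by move=> hg hh; apply: RintegralD => //; exact: bddmeas_integrable. Qed.

Lemma EEZ c g : bddmeas g -> EE (fun U => c * g U) = c * EE g.
Proof. by move=> hg; apply: RintegralZl => //; exact: bddmeas_integrable. Qed.

Lemma EE_sum (I : Type) (s : seq I) (F : I -> cmx_meas R n -> R) :
  (forall i, bddmeas (F i)) ->
  EE (fun U => \sum_(i <- s) F i U) = \sum_(i <- s) EE (F i).
Proof.
move=> hF; elim: s => [|i s IH].
  rewrite big_nil /EE; under eq_Rintegral do rewrite big_nil.
  by rewrite Rintegral_cst // mul0r.
rewrite big_cons -IH -EED //; last exact: bddmeas_sum.
by apply: eq_Rintegral => U _; rewrite big_cons.
Qed.

Lemma EE_le g h : bddmeas g -> bddmeas h ->
  (forall U, unitary U -> g U <= h U) -> EE g <= EE h.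
Proof. by move=> hg hh gh; apply: le_Rintegral => //; exact: bddmeas_integrable. Qed.

Lemma EE_ge0 g : (forall U, unitary U -> 0 <= g U) -> 0 <= EE g.
Proof. by move=> h; apply: Rintegral_ge0 => U; exact: h. Qed.

Lemma EE1 : EE (fun=> 1) = 1.
Proof.
by have [P1 _] := haarP; rewrite /EE Rintegral_cst //= P1 mul1r.
Qed.

Lemma EE_indic (A : set (cmx_meas R n)) : measurable A -> EE \1_A = fine (P A).
Proof.
move=> mA; rewrite /EE /Rintegral integral_indic //; congr fine.
have [P1 _] := haarP.
have PD0 : P (~` D) = 0%E.
  by rewrite probability_setC // P1 subee.
have mAD : measurable (A `&` ~` D) by apply: measurableI => //; exact: measurableC.
have PAD : P (A `&` ~` D) = 0%E.
  apply/eqP; rewrite eq_le measure_ge0 andbT -PD0.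
  by apply: le_measure; rewrite ?inE //; exact: measurableC.
rewrite -[in RHS](setIT A) -(setUv D) setIUr measureU //.
- by rewrite [X in (_ + X)%E](_ : _ = 0%E) ?adde0 //; exact: PAD.
- exact: measurableI.
- by rewrite setIACA setICr setI0.
Qed.

Lemma measurable_mul_unitary (V : 'M[R[i]]_n) :
  measurable_fun [set: cmx_meas R n]
    (fun U : cmx_meas R n => (V *m (U : 'M[R[i]]_n) : cmx_meas R n)).
Proof.
apply: (@measurability _ _ _ (cmx_meas R n) setT _ (@cmx_gen R n) erefl).
move=> _ [_ [i [j [B [mB [->|->]]]]] <-].
  rewrite setTI.
  pose g (U : cmx_meas R n) := \sum_l (complex.Re (V i l) * complex.Re ((U : 'M[R[i]]_n) l j)
    - complex.Im (V i l) * complex.Im ((U : 'M[R[i]]_n) l j)).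
  have mg : meas g.
    apply: measurable_sum => l; apply: measurable_funD; last apply: measN.
      by apply: measurable_funM => //; exact: meas_Re.
    by apply: measurable_funM => //; exact: meas_Im.
  have e (U : 'M[R[i]]_n) : complex.Re ((V *m U) i j) = g U.
    rewrite mxE raddf_sum; apply: eq_bigr => l _.
    by case: (V i l) (U l j) => [a b] [c d].
  rewrite (_ : _ @^-1` _ = g @^-1` B); last first.
    by apply/seteqP; split => U /=; rewrite e.
  by rewrite -[X in measurable X]setTI; exact: mg.
rewrite setTI.
pose g (U : cmx_meas R n) := \sum_l (complex.Re (V i l) * complex.Im ((U : 'M[R[i]]_n) l j)
    + complex.Im (V i l) * complex.Re ((U : 'M[R[i]]_n) l j)).
have mg : meas g.
  apply: measurable_sum => l; apply: measurable_funD.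
    by apply: measurable_funM => //; exact: meas_Im.
  by apply: measurable_funM => //; exact: meas_Re.
have e (U : 'M[R[i]]_n) : complex.Im ((V *m U) i j) = g U.
  rewrite mxE raddf_sum; apply: eq_bigr => l _.
  by case: (V i l) (U l j) => [a b] [c d].
rewrite (_ : _ @^-1` _ = g @^-1` B); last first.
  by apply/seteqP; split => U /=; rewrite e.
by rewrite -[X in measurable X]setTI; exact: mg.
Qed.

Lemma bddmeas_mul_unitary (V : 'M[R[i]]_n) g : unitary V ->
  bddmeas g -> bddmeas (fun U => g (V *m (U : 'M[R[i]]_n))).
Proof.
move=> uV [mg [K hK]]; split.
  exact: (measurableT_comp mg (measurable_mul_unitary V)).
by exists K => U uU; apply: hK; exact: unitary_mul.
Qed.

(** Invariance makes [P] its own image under left multiplication by [V], which also maps U(n) onto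
    itself. Nonnegativity serves the change of variables formula. *)
Lemma EE_invariant (V : 'M[R[i]]_n) g : unitary V ->
  bddmeas g -> (forall U, 0 <= g U) ->
  EE (fun U => g (V *m (U : 'M[R[i]]_n))) = EE g.
Proof.
move=> uV hg g0; rewrite /EE /Rintegral; congr fine.
pose phi (U : cmx_meas R n) : cmx_meas R n := V *m (U : 'M[R[i]]_n).
have mphi : measurable_fun setT phi by exact: measurable_mul_unitary.
have preD : phi @^-1` D = D.
  apply/seteqP; split => U; last by move=> uU; exact: unitary_mul.
  move=> /unitary_etaP; rewrite eta_mul trmx_mul => h; apply/unitary_etaP.
  move/unitary_etaP : uV => uV; have uV' := mulmx1C uV.
  have : (eta V)^T *m (eta V *m eta U *m ((eta U)^T *m (eta V)^T)) *m eta V = 1%:M.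
    by rewrite h mulmx1.
  by rewrite !mulmxA uV' mul1mx -!mulmxA uV' mulmx1.
have [_ inv] := haarP.
rewrite -!/D -{1}preD.
rewrite -(@ge0_integral_pushforward _ _ _ _ _ phi mphi P D (EFin \o g)) //.
- apply: eq_measure_integral => A mA _; rewrite /pushforward; exact: inv.
- by apply/measurable_EFinP; apply: measurable_funTS; have [] := hg.
- by move=> U _; rewrite lee_fin.
Qed.

(** After integration both terms on the left equal [EE g], so [2 * EE g] cancels and only the
    corrections survive. *)
Lemma EE_pair_invariant (V V' : 'M[R[i]]_n) g h (a b : R) :
  unitary V -> unitary V' -> bddmeas g -> bddmeas h -> (forall U, 0 <= g U) ->
  (forall U, unitary U ->
     g (V *m U) + g (V' *m U) <= 2 * g U + a * (g U * h U) + b * g U) ->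
  0 <= a * EE (fun U => g U * h U) + b * EE g.
Proof.
move=> uV uV' hg hh g0 le_g.
have bV := bddmeas_mul_unitary uV hg; have bV' := bddmeas_mul_unitary uV' hg.
have b1 := bddmeasZ 2 hg; have b2 := bddmeasZ a (bddmeasM hg hh).
have b3 := bddmeasZ b hg; have b12 := bddmeasD b1 b2.
have := EE_le (bddmeasD bV bV') (bddmeasD b12 b3) le_g.
rewrite (EED bV bV') (EE_invariant uV hg g0) (EE_invariant uV' hg g0).
rewrite (EED b12 b3) (EED b1 b2) (EEZ 2 hg) (EEZ a (bddmeasM hg hh)) (EEZ b hg).
lra.
Qed.

End Expectation.

(** * Stationarity of the Haar measure along one-parameter rotations *)

Section Taylor.
Variable R : realType.

(** From [expR x <= 1 / (1 - x)]. The coefficient 2 in place of 1/2 only affects constants; it is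
    the source of the factor 2 in front of [th] in [Psi]. *)
Lemma expR_taylor2 (x : R) : `|x| <= 2^-1 -> expR x <= 1 + x + 2 * x ^+ 2.
Proof.
rewrite ler_norml => /andP[x1 x2].
have x0 : 0 < 1 - x by lra.
have h : 1 - x <= expR (- x) by exact: expR_ge1Dx.
have -> : expR x = (expR (- x))^-1 by rewrite expRN invrK.
apply: (@le_trans _ _ (1 - x)^-1); first by rewrite lef_pV2 // posrE expR_gt0.
by rewrite -div1r ler_pdivrMr //; have := sqr_ge0 x; nra.
Qed.

Lemma limit_ge0 (y c s0 : R) : 0 < s0 -> 0 <= c ->
  (forall s : R, 0 < s -> s <= s0 -> 0 <= y + c * s) -> 0 <= y.
Proof.
move=> s0_gt0 c0 h; rewrite leNgt; apply/negP => y0.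
have c1 : 0 < 2 * (c + 1) by lra.
pose s := Num.min s0 (- y / (2 * (c + 1))).
have s_gt0 : 0 < s by rewrite lt_min s0_gt0 divr_gt0 // oppr_gt0.
have s_le : s * (2 * (c + 1)) <= - y by rewrite -ler_pdivlMr // ge_min lexx orbT.
have := h s s_gt0; rewrite ge_min lexx => /(_ isT); nra.
Qed.

(** Write [e = s d + u] with [u = O(s^2)]. In [e^2] the cross term and [u^2] are both [O(s^3)], and
    the smallness of [s] keeps [th * e] in the range of [expR_taylor2]. *)
Lemma taylor_err (s th K K1 W e d : R) : 0 < s -> s <= 1 -> 0 < th -> 0 <= K1 ->
  0 <= W -> W <= K -> s * (2 * th * (K1 + 32 * K) + 1) <= 1 ->
  `|d| <= K1 -> `|e - s * d| <= 32 * s ^+ 2 * W ->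
  `|th * e| <= 2^-1 /\
  e ^+ 2 <= s ^+ 2 * d ^+ 2 + s ^+ 3 * (64 * K1 * K + 1024 * K ^+ 2).
Proof.
move=> s0 s1 th0 K10 W0 WK sd dK eW.
have K0 : 0 <= K := le_trans W0 WK.
pose u := e - s * d; have eE : e = s * d + u by rewrite /u addrC subrK.
have s2 : s ^+ 2 <= s by rewrite expr2 -[leRHS]mulr1 ler_wpM2l // ltW.
have uK : `|u| <= 32 * s ^+ 2 * K by apply: le_trans eW _; rewrite ler_wpM2l // mulr_ge0 ?sqr_ge0.
have uK' : `|u| <= s * (32 * K).
  apply: le_trans uK _; rewrite mulrAC mulrC ler_wpM2r ?mulr_ge0 //.
split.
  rewrite normrM gtr0_norm //.
  have : `|e| <= s * (K1 + 32 * K).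
    rewrite eE (le_trans (ler_normD _ _)) // mulrDr lerD // normrM gtr0_norm //.
    by rewrite ler_wpM2l // ltW.
  by move=> h; have := ler_wpM2l (ltW th0) h; nra.
have du : d * u <= K1 * (32 * s ^+ 2 * K).
  by rewrite (le_trans (ler_norm _)) // normrM ler_pM.
have u2 : u ^+ 2 <= (32 * s ^+ 2 * K) * (s * (32 * K)).
  by rewrite -real_normK ?num_real // expr2 ler_pM.
rewrite eE; have := ler_wpM2l (ltW s0) du; nra.
Qed.

Lemma expR_pair_taylor (s th K Q e1 e2 d1 d2 : R) : 0 < th ->
  `|th * e1| <= 2^-1 -> `|th * e2| <= 2^-1 ->
  e1 + e2 <= 2 * s ^+ 2 * d2 + 64 * s ^+ 3 * K ->
  e1 ^+ 2 <= s ^+ 2 * d1 ^+ 2 + s ^+ 3 * Q ->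
  e2 ^+ 2 <= s ^+ 2 * d1 ^+ 2 + s ^+ 3 * Q ->
  expR (th * e1) + expR (th * e2) <=
  2 + 2 * s ^+ 2 * th * (d2 + 2 * th * d1 ^+ 2)
  + s ^+ 3 * (64 * th * K + 4 * th ^+ 2 * Q).
Proof.
move=> th0 h1 h2 es q1 q2; have x1 := expR_taylor2 h1; have x2 := expR_taylor2 h2.
have y1 := ler_wpM2l (ltW th0) es.
have y2 := ler_wpM2l (sqr_ge0 th) q1; have y3 := ler_wpM2l (sqr_ge0 th) q2.
rewrite exprMn in x1; rewrite exprMn in x2; lra.
Qed.

Variables (p q : nat) (D A B C E G : 'M[R]_(p, q)).

(** The exact increment of the deviation under a rotation, without remainder: [A] is of first order,
    [B] and [C] of second, [E] of third and [G] of fourth order in [s]. *)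
Definition taylor_inc (s h : R) : 'M[R]_(p, q) :=
  s *: A + (s ^+ 2 * h) *: B - s ^+ 2 *: C + (s ^+ 3 * h) *: E
  + (s ^+ 4 * h ^+ 2) *: G.

Definition taylor_bound : R :=
  fsq D + fsq A + fsq B + fsq C + fsq E + fsq G.

Let W := taylor_bound.

Let fs := (fsq_ge0 D, fsq_ge0 A, fsq_ge0 B, fsq_ge0 C, fsq_ge0 E, fsq_ge0 G).

Lemma taylor_bound_ge0 : 0 <= W.
Proof. by rewrite /W /taylor_bound; move: fs => [[[[[]]]]]; lra. Qed.

Lemma fsqZ_le (c : R) (F : 'M[R]_(p, q)) : `|c| <= 1 -> fsq (c *: F) <= fsq F.
Proof.
move=> c1; rewrite fsqZ -[leRHS]mul1r ler_wpM2r ?fsq_ge0 //.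
by rewrite -real_normK ?num_real // expr_le1.
Qed.

Lemma fsq_taylor1 (s h : R) : `|s| <= 1 -> 0 <= h <= 1 ->
  `|fsq (D + taylor_inc s h) - fsq D - s * (2 * fdot D A)| <= 32 * s ^+ 2 * W.
Proof.
move=> s1 /andP[h0 h1].
pose T := h *: B - C + ((s * h) *: E + (s ^+ 2 * h ^+ 2) *: G).
have -> : taylor_inc s h = s *: A + s ^+ 2 *: T.
  by rewrite /T /taylor_inc; apply/matrixP => i j; rewrite !mxE; ring.
have nh : `|h| <= 1 by rewrite ger0_norm.
have hT : fsq T <= 4 * (fsq B + fsq C + fsq E + fsq G).
  have t1 := fsqD_le (h *: B - C) ((s * h) *: E + (s ^+ 2 * h ^+ 2) *: G).
  have t2 := fsqD_le (h *: B) (- C).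
  have t3 := fsqD_le ((s * h) *: E) ((s ^+ 2 * h ^+ 2) *: G).
  have t4 := fsqZ_le B nh.
  have t5 : fsq ((s * h) *: E) <= fsq E by apply: fsqZ_le; rewrite normrM mulr_ile1.
  have t6 : fsq ((s ^+ 2 * h ^+ 2) *: G) <= fsq G.
    by apply: fsqZ_le; rewrite normrM !normrX mulr_ile1 ?exprn_ge0 ?expr_le1.
  rewrite fsqN in t2; rewrite -/T in t1; lra.
have -> : fsq (D + (s *: A + s ^+ 2 *: T)) - fsq D - s * (2 * fdot D A) =
    s ^+ 2 * (2 * fdot D T + fsq (A + s *: T)).
  rewrite !fsqD fdotDr !fdotZr fdotZl !fsqZ; ring.
rewrite normrM ger0_norm ?sqr_ge0 // (_ : 32 * _ * _ = s ^+ 2 * (32 * W)); last by ring.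
rewrite ler_wpM2l ?sqr_ge0 //.
have u1 := fsqD_le A (s *: T); have u2 := fsqZ_le T s1.
have u3 := fdot_le D T; have u4 := fdot_le D (- T).
rewrite fdotNr fsqN in u4.
have := fsq_ge0 (A + s *: T); rewrite /W /taylor_bound ler_norml.
by move: fs => [[[[[]]]]]; lra.
Qed.

(** Passing from [s] to [- s] flips the odd part [u] of the increment and keeps the even part [v],
    so odd powers of [s] drop out. The equation for [h] says [h = 1/2 + O(s^2)], which turns
    [h *: B] into [2^-1 *: B] up to order 4. *)
Lemma fsq_taylor2 (s h : R) : `|s| <= 1 -> 0 <= h <= 1 ->
  2 * h = 1 + s ^+ 2 * h ^+ 2 ->
  fsq (D + taylor_inc s h) + fsq (D + taylor_inc (- s) h) - 2 * fsq D <=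
  2 * s ^+ 2 * (2 * fdot D (2^-1 *: B - C) + fsq A) + 64 * s ^+ 4 * W.
Proof.
move=> s1 /andP[h0 h1] hs.
pose T0 := h *: B - C + (s ^+ 2 * h ^+ 2) *: G.
pose u := s *: (A + (s ^+ 2 * h) *: E).
pose v := s ^+ 2 *: T0.
have -> : D + taylor_inc s h = D + v + u.
  by rewrite /u /v /T0 /taylor_inc; apply/matrixP => i j; rewrite !mxE; ring.
have -> : D + taylor_inc (- s) h = D + v - u.
  by rewrite /u /v /T0 /taylor_inc; apply/matrixP => i j; rewrite !mxE; ring.
have -> : fsq (D + v + u) + fsq (D + v - u) - 2 * fsq D =
    4 * fdot D v + 2 * fsq v + 2 * fsq u.
  rewrite (fsqD (D + v) u) (fsqD (D + v) (- u)) fdotNr fsqN fsqD; ring.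
have nh : `|h| <= 1 by rewrite ger0_norm.
have ns2 : `|s ^+ 2| <= 1 by rewrite normrX expr_le1.
have hT : fsq T0 <= 4 * (fsq B + fsq C + fsq G).
  have t1 := fsqD_le (h *: B - C) ((s ^+ 2 * h ^+ 2) *: G).
  have t2 := fsqD_le (h *: B) (- C).
  have t4 := fsqZ_le B nh.
  have t6 : fsq ((s ^+ 2 * h ^+ 2) *: G) <= fsq G.
    by apply: fsqZ_le; rewrite normrM !normrX mulr_ile1 ?exprn_ge0 ?expr_le1.
  rewrite fsqN in t2; rewrite -/T0 in t1; have := fsq_ge0 G; lra.
have -> : 4 * fdot D v + 2 * fsq v + 2 * fsq u =
    2 * s ^+ 2 * (2 * fdot D (2^-1 *: B - C) + fsq A)
    + s ^+ 4 * (2 * (h ^+ 2 * fdot D B) + 4 * (h ^+ 2 * fdot D G)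
        + 4 * (h * fdot A E) + 2 * (s ^+ 2 * h ^+ 2 * fsq E) + 2 * fsq T0).
  have -> : fdot D v = s ^+ 2 * (h * fdot D B - fdot D C + s ^+ 2 * h ^+ 2 * fdot D G).
    by rewrite /v fdotZr /T0 fdotDr fdotDr fdotNr !fdotZr.
  have -> : fsq u = s ^+ 2 * (fsq A + 2 * (s ^+ 2 * h * fdot A E) + (s ^+ 2 * h) ^+ 2 * fsq E).
    by rewrite /u fsqZ fsqD fdotZr fsqZ.
  rewrite /v fsqZ fdotDr fdotNr fdotZr.
  apply/eqP; rewrite -subr_eq0; set l := (X in X == 0).
  have -> : l = 2 * s ^+ 2 * fdot D B * (2 * h - (1 + s ^+ 2 * h ^+ 2)).
    by rewrite /l; field.
  by rewrite hs subrr mulr0.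
rewrite lerD2l (_ : 64 * _ * _ = s ^+ 4 * (64 * W)); last by ring.
rewrite ler_wpM2l ?exprn_even_ge0 //.
have W0 := taylor_bound_ge0.
have bnd c x : 0 <= c <= 1 -> `|x| <= W -> c * x <= W.
  move=> /andP[c0 c1]; rewrite ler_norml => /andP[x1 x2].
  by case: (leP 0 x) => x0; nra.
have h2 : 0 <= h ^+ 2 <= 1 by rewrite exprn_ge0 // expr_le1.
have b1 : h ^+ 2 * fdot D B <= W.
  apply: bnd => //; apply: le_trans (normr_fdot_le _ _) _; rewrite /W /taylor_bound.
  by move: fs => [[[[[]]]]]; lra.
have b2 : h ^+ 2 * fdot D G <= W.
  apply: bnd => //; apply: le_trans (normr_fdot_le _ _) _; rewrite /W /taylor_bound.
  by move: fs => [[[[[]]]]]; lra.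
have b3 : h * fdot A E <= W.
  apply: bnd; first by rewrite h0.
  apply: le_trans (normr_fdot_le _ _) _; rewrite /W /taylor_bound.
  by move: fs => [[[[[]]]]]; lra.
have b4 : s ^+ 2 * h ^+ 2 * fsq E <= W.
  apply: bnd.
    have := h2 => /andP[h20 h21]; rewrite mulr_ge0 ?sqr_ge0 //= mulr_ile1 ?sqr_ge0 //.
    by rewrite -[leLHS]ger0_norm ?sqr_ge0.
  rewrite ger0_norm ?fsq_ge0 // /W /taylor_bound; by move: fs => [[[[[]]]]]; lra.
have b5 : fsq T0 <= 4 * W.
  by apply: le_trans hT _; rewrite /W /taylor_bound; move: fs => [[[[[]]]]]; lra.
lra.
Qed.

End Taylor.

(** * Rotations in U(n) and the transport of the deviation along them *)

Lemma conj_rotation (R : comNzRingType) p (X Y M : 'M[R]_p) (s r : R) :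
  (1%:M + s *: X + r *: Y) *m M *m (1%:M - s *: X + r *: Y) =
  M + s *: (X *m M - M *m X) + r *: (Y *m M + M *m Y) - s ^+ 2 *: (X *m M *m X)
  + (s * r) *: (X *m M *m Y - Y *m M *m X) + r ^+ 2 *: (Y *m M *m Y).
Proof.
rewrite !(mulmxDl, mulmxDr) !(mulmxN, mulNmx) -!(scalemxAl, scalemxAr).
rewrite !(mul1mx, mulmx1).
move: (X *m M *m X) (X *m M *m Y) (Y *m M *m X) (Y *m M *m Y) => XMX XMY YMX YMY.
move: (X *m M) (M *m X) (Y *m M) (M *m Y) => XM MX YM MY.
by apply/matrixP => i j; rewrite !mxE; ring.
Qed.

Section Concentration.
Variables (R : realType) (n k : nat) (z : 'I_n -> R).
Hypothesis kn : (k <= n)%N.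

Let S := selmx R k n.

(** Rodrigues' formula: for [X^3 = - X] and [s] the sine of the angle, [exp] of the angle times [X]
    is [1 + s X + (1 - cos) X^2], with [1 - cos = s^2 h] and [h = 1 / (1 + cos)]. In this form
    everything is polynomial in [s] and [h]. *)
Definition rot (x : 'M[R[i]]_n) (s h : R) : 'M[R[i]]_n :=
  1%:M + (s%:C)%C *: x + ((s ^+ 2 * h)%:C)%C *: (x *m x).

Lemma eta_rot x s h :
  eta (rot x s h) = 1%:M + s *: eta x + (s ^+ 2 * h) *: (eta x *m eta x).
Proof. by rewrite /rot !etaD !etaZ eta_mul eta1. Qed.

Section Rotation.
Variable x : 'M[R[i]]_n.
Let X := eta x.
Hypothesis XT : X^T = - X.
Hypothesis X3 : X *m X *m X = - X.

Lemma eta_rot_tr s h :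
  (eta (rot x s h))^T = 1%:M - s *: X + (s ^+ 2 * h) *: (X *m X).
Proof.
rewrite eta_rot -/X !raddfD /= !linearZ /= trmx1 trmx_mul XT mulmxN mulNmx opprK.
by rewrite scalerN.
Qed.

(** With [X^4 = - X^2], the product with the transpose is [1 + s^2 (2 h - 1 - s^2 h^2) X^2]. *)
Lemma unitary_rot s h : 2 * h = 1 + s ^+ 2 * h ^+ 2 -> unitary (rot x s h).
Proof.
move=> hs; apply/unitary_etaP; rewrite eta_rot_tr eta_rot -/X -[_ + _ *: (X *m X)]mulmx1.
rewrite conj_rotation !(mul1mx, mulmx1) subrr scaler0 addr0.
have X4 : X *m X *m (X *m X) = - (X *m X) by rewrite mulmxA X3 mulNmx.
rewrite (mulmxA X X X) subrr scaler0 addr0 X4.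
move: (X *m X) => Y; set l := LHS.
have -> : l = 1%:M + (s ^+ 2 * (2 * h - (1 + s ^+ 2 * h ^+ 2))) *: Y.
  by rewrite /l; apply/matrixP => i j; rewrite !mxE; ring.
by rewrite hs subrr mulr0 scale0r addr0.
Qed.

Variable U : 'M[R[i]]_n.
Let M := Mn z U.
Let L T := S *m T *m S^T.

Definition rotB := L (X *m X *m M + M *m (X *m X)).
Definition rotC := L (X *m M *m X).
Definition rotE := L (X *m M *m (X *m X) - X *m X *m M *m X).
Definition rotG := L (X *m X *m M *m (X *m X)).

Lemma dev_rot s h : dev k z (rot x s h *m U) =
  dev k z U + taylor_inc (dev1 k z U X) rotB rotC rotE rotG s h.
Proof.
have LD A B : L (A + B) = L A + L B by rewrite /L mulmxDr mulmxDl.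
have LZ c A : L (c *: A) = c *: L A by rewrite /L -scalemxAr -scalemxAl.
have LN A : L (- A) = - L A by rewrite /L mulmxN mulNmx.
rewrite /dev !Mnk_sel // -!/(L _) /taylor_inc /dev1 -/(L _) /rotB /rotC /rotE /rotG.
have -> : Mn z (rot x s h *m U) = eta (rot x s h) *m M *m (eta (rot x s h))^T.
  by rewrite /M /Mn eta_mul trmx_mul !mulmxA.
rewrite eta_rot_tr eta_rot -/X conj_rotation -/M.
rewrite !(LD, LZ, LN).
move: (L (X *m M *m (X *m X))) (L (X *m X *m M *m X)) (L (X *m X *m M *m (X *m X))) => l1 l2 l3.
move: (L (X *m X *m M)) (L (M *m (X *m X))) (L (X *m M *m X)) => l4 l5 l6.
move: (L (X *m M)) (L (M *m X)) (L M) => l7 l8 l9.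
by apply/matrixP => i j; rewrite !mxE; ring.
Qed.

Lemma dev2_rot : dev2 k z U X = 2^-1 *: rotB - rotC.
Proof.
by rewrite /dev2 XT mulmxN mulmxDr mulmxDl -scalemxAr -scalemxAl mulmxN mulNmx.
Qed.

End Rotation.

Lemma rot_param (s : R) : `|s| <= 1 ->
  exists2 h : R, 0 <= h <= 1 & 2 * h = 1 + s ^+ 2 * h ^+ 2.
Proof.
move=> s1; have s2 : 0 <= 1 - s ^+ 2.
  by rewrite subr_ge0 -real_normK ?num_real // expr_le1.
pose c := Num.sqrt (1 - s ^+ 2).
have c0 : 0 <= c by exact: sqrtr_ge0.
have c2 : s ^+ 2 = 1 - c ^+ 2 by rewrite sqr_sqrtr // opprB addrC subrK.
have c1 : 0 < 1 + c by lra.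
exists (1 + c)^-1.
  by rewrite invr_ge0 (ltW c1) invf_le1 //; lra.
by rewrite c2; field; rewrite lt0r_neq0.
Qed.

(** * Measurability and boundedness of the derivatives *)

Lemma bddmeas_Mn : bddmeas_mx (fun U : cmx_meas R n => Mn z U).
Proof.
apply: bddmeas_mxM; last exact/bddmeas_mxT/bddmeas_eta.
by apply: bddmeas_mxM; [exact: bddmeas_eta|exact: bddmeas_mx_cst].
Qed.

Lemma bddmeas_sel (F : cmx_meas R n -> 'M[R]_(n + n)) :
  bddmeas_mx F -> bddmeas_mx (fun U => S *m F U *m S^T).
Proof.
move=> hF; apply: bddmeas_mxM; last exact: bddmeas_mx_cst.
by apply: bddmeas_mxM => //; exact: bddmeas_mx_cst.
Qed.

Lemma bddmeas_dev : bddmeas_mx (fun U : cmx_meas R n => dev k z U).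
Proof.
apply: bddmeas_mxD; last exact: bddmeas_mx_cst.
move=> i j; have := bddmeas_sel bddmeas_Mn i j.
rewrite (_ : (fun U => _) = (fun U : cmx_meas R n => Mnk k z U i j)) //.
by apply/funext => U; rewrite Mnk_sel.
Qed.

Lemma bddmeas_wordl (A : 'M[R]_(n + n)) (F : cmx_meas R n -> 'M[R]_(n + n)) :
  bddmeas_mx F -> bddmeas_mx (fun U => A *m F U).
Proof. by move=> hF; apply: bddmeas_mxM => //; exact: bddmeas_mx_cst. Qed.

Lemma bddmeas_wordr (A : 'M[R]_(n + n)) (F : cmx_meas R n -> 'M[R]_(n + n)) :
  bddmeas_mx F -> bddmeas_mx (fun U => F U *m A).
Proof. by move=> hF; apply: bddmeas_mxM => //; exact: bddmeas_mx_cst. Qed.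

Let bM := bddmeas_Mn.

Lemma bddmeas_dev1 X : bddmeas_mx (fun U : cmx_meas R n => dev1 k z U X).
Proof.
apply: bddmeas_sel; apply: bddmeas_mxD; first exact: bddmeas_wordl.
by apply: bddmeas_mxN; exact: bddmeas_wordr.
Qed.

Lemma bddmeas_dev2 X : bddmeas_mx (fun U : cmx_meas R n => dev2 k z U X).
Proof.
apply: bddmeas_sel; apply: bddmeas_mxD.
  by apply: bddmeas_mxZ; apply: bddmeas_mxD; [exact: bddmeas_wordl|exact: bddmeas_wordr].
by apply: bddmeas_wordr; exact: bddmeas_wordl.
Qed.

Lemma bddmeas_fsq p q (F : cmx_meas R n -> 'M[R]_(p, q)) :
  bddmeas_mx F -> bddmeas (fun U => fsq (F U)).
Proof. by move=> hF; exact: bddmeas_fdot. Qed.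

Lemma bddmeas_der1 X : bddmeas (fun U : cmx_meas R n => der1 k z U X).
Proof.
apply: bddmeasM; first exact: bddmeas_cst.
by apply: bddmeas_fdot; [exact: bddmeas_dev|exact: bddmeas_dev1].
Qed.

Lemma bddmeas_der2 X : bddmeas (fun U : cmx_meas R n => der2 k z U X).
Proof.
apply: bddmeasD; last exact/bddmeas_fsq/bddmeas_dev1.
apply: bddmeasM; first exact: bddmeas_cst.
by apply: bddmeas_fdot; [exact: bddmeas_dev|exact: bddmeas_dev2].
Qed.

Lemma bddmeas_taylor_bound x : bddmeas (fun U : cmx_meas R n =>
  taylor_bound (dev k z U) (dev1 k z U (eta x)) (rotB x U) (rotC x U) (rotE x U) (rotG x U)).
Proof.
do !apply: bddmeasD; apply: bddmeas_fsq.
- exact: bddmeas_dev.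
- exact: bddmeas_dev1.
- by apply: bddmeas_sel; apply: bddmeas_mxD; [exact: bddmeas_wordl|exact: bddmeas_wordr].
- by apply: bddmeas_sel; apply: bddmeas_wordr; exact: bddmeas_wordl.
- apply: bddmeas_sel; apply: bddmeas_mxD; last apply: bddmeas_mxN;
  by apply: bddmeas_wordr; exact: bddmeas_wordl.
- by apply: bddmeas_sel; apply: bddmeas_wordr; exact: bddmeas_wordl.
Qed.

(** * Stationarity and the exponential tail of the squared deviation *)

Variable P : probability (cmx_meas R n) R.
Hypothesis haarP : is_Haar P.
Variable th : R.
Hypothesis th_gt0 : 0 < th.

Let f (U : cmx_meas R n) : R := fsq (dev k z U).
Let w U := expR (th * f U).

Let bf : bddmeas f. Proof. exact/bddmeas_fsq/bddmeas_dev. Qed.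
Let bw : bddmeas w.
Proof. by apply: bddmeas_expR; apply: bddmeasM => //; exact: bddmeas_cst. Qed.

Let Psi X (U : cmx_meas R n) := der2 k z U X + 2 * th * der1 k z U X ^+ 2.

Let bPsi X : bddmeas (Psi X).
Proof.
apply: bddmeasD; first exact: bddmeas_der2.
apply: bddmeasM; first exact: bddmeas_cst.
by under eq_fun do rewrite expr2; apply: bddmeasM; exact: bddmeas_der1.
Qed.

(* Rotating [U] by both [s] and [- s] and expanding to second order, the
   first-order terms cancel; letting [s] tend to 0 gives the claim. *)
Lemma stationarity_rot x : (eta x)^T = - eta x ->
  eta x *m eta x *m eta x = - eta x -> 0 <= EE P (fun U => w U * Psi (eta x) U).
Proof.
move=> XT X3; set X := eta x.
have [_ [K hK]] := bddmeas_taylor_bound x; have [_ [K1 hK1]] := bddmeas_der1 X.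
(* One unitary matrix suffices to see that the bounds [K] and [K1] are nonnegative. *)
have uid : unitary (1%:M : 'M[R[i]]_n).
  by apply/unitary_etaP; rewrite eta1 trmx1 mulmx1.
have K0 : 0 <= K by apply: le_trans (hK _ uid).
have K10 : 0 <= K1 by apply: le_trans (hK1 _ uid).
pose c := 64 * th * K + 4 * th ^+ 2 * (64 * K1 * K + 1024 * K ^+ 2).
have th0 := ltW th_gt0.
have Q0 : 0 <= 64 * K1 * K + 1024 * K ^+ 2.
  by have := mulr_ge0 K10 K0; have := sqr_ge0 K; lra.
have tK := mulr_ge0 th0 K0; have tK1 := mulr_ge0 th0 K10.
have c0 : 0 <= c by rewrite /c; have := mulr_ge0 (sqr_ge0 th) Q0; lra.
(* For [s <= 1 / d] both exponents [th * e] stay within 1/2; the summand 1 also ensures [s <= 1]. *)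
pose d := 2 * th * (K1 + 32 * K) + 1.
have thK : 0 <= 2 * th * (K1 + 32 * K) by lra.
have d0 : 0 < d by rewrite /d ltr_wpDl.
have w0 : 0 <= EE P w by apply: EE_ge0 => U _; exact: expR_ge0.
apply: (@limit_ge0 _ _ (c * EE P w / (2 * th)) d^-1); first by rewrite invr_gt0.
  by rewrite divr_ge0 ?mulr_ge0 // ltW.
move=> s s0 sd.
have s1 : s <= 1 by rewrite (le_trans sd) // invf_le1 // /d lerDr.
have ns : `|s| <= 1 by rewrite gtr0_norm.
have nNs : `|- s| <= 1 by rewrite normrN.
have sd' : s * d <= 1 by rewrite -ler_pdivlMr // div1r.
have [h h01 hs] := rot_param ns.
have hsN : 2 * h = 1 + (- s) ^+ 2 * h ^+ 2 by rewrite sqrrN.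
have uV := unitary_rot XT X3 hs; have uVN := unitary_rot XT X3 hsN.
pose V := rot x s h; pose V' := rot x (- s) h.
have pw (U : 'M[R[i]]_n) : unitary U ->
    w (V *m U) + w (V' *m U) <= 2 * w U + (2 * s ^+ 2 * th) * (w U * Psi X U) + (s ^+ 3 * c) * w U.
  move=> uU; rewrite /w /f !dev_rot // -/(f U).
  set T := taylor_inc _ _ _ _ _ _; set B := rotB x U; set C := rotC x U.
  have t1 := fsq_taylor1 (dev k z U) (dev1 k z U X) B C (rotE x U) (rotG x U) ns h01.
  have t2 := fsq_taylor1 (dev k z U) (dev1 k z U X) B C (rotE x U) (rotG x U) nNs h01.
  have t3 := fsq_taylor2 (dev k z U) (dev1 k z U X) B C (rotE x U) (rotG x U) ns h01 hs.
  rewrite -/T -/(f U) -/(der1 k z U X) in t1.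
  rewrite -/T -/(f U) -/(der1 k z U X) sqrrN mulNr opprK in t2.
  rewrite -(dev2_rot XT) -/T -/(f U) -/(der2 k z U X) in t3.
  have W0 := taylor_bound_ge0 (dev k z U) (dev1 k z U X) B C (rotE x U) (rotG x U).
  have WK := hK U uU; rewrite ger0_norm // in WK.
  move: WK W0 t1 t2 t3; set W := taylor_bound _ _ _ _ _ _ => WK W0.
  have dK := hK1 U uU; rewrite /Psi; move: dK.
  set d1 := der1 k z U X; set d2 := der2 k z U X.
  set fp := fsq _; set fm := fsq _ => dK t1 t2 t3.
  pose e1 := fp - f U; pose e2 := fm - f U.
  have -> : fp = f U + e1 by rewrite /e1 addrC subrK.
  have -> : fm = f U + e2 by rewrite /e2 addrC subrK.
  rewrite -/e1 in t1; rewrite -/e2 in t2.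
  have {}t3 : e1 + e2 <= 2 * s ^+ 2 * d2 + 64 * s ^+ 4 * W.
    by apply: le_trans t3; rewrite /e1 /e2; lra.
  rewrite (mulrDr th _ e1) (mulrDr th _ e2) !expRD -mulrDr.
  have [e1h e1s] := taylor_err s0 s1 th_gt0 K10 W0 WK sd' dK t1.
  have [e2h e2s] : `|th * e2| <= 2^-1 /\
      e2 ^+ 2 <= s ^+ 2 * (- d1) ^+ 2 + s ^+ 3 * (64 * K1 * K + 1024 * K ^+ 2).
    by apply: (taylor_err s0 s1 th_gt0 K10 W0 WK sd'); rewrite ?normrN // mulrN opprK.
  rewrite sqrrN in e2s.
  have s43 : 64 * s ^+ 4 * W <= 64 * s ^+ 3 * K.
    have s4 : s ^+ 4 <= s ^+ 3.
      by rewrite exprSr -[leRHS]mulr1 ler_wpM2l // exprn_ge0 // ltW.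
    by have := ler_pM (exprn_ge0 4 (ltW s0)) W0 s4 WK; lra.
  have {}t3 : e1 + e2 <= 2 * s ^+ 2 * d2 + 64 * s ^+ 3 * K by lra.
  have := expR_pair_taylor th_gt0 e1h e2h t3 e1s e2s; rewrite -/c.
  move=> /(ler_wpM2l (expR_ge0 (th * f U))) /le_trans; apply.
  by rewrite le_eqVlt; apply/orP; left; apply/eqP; ring.
have w_ge0 U : 0 <= w U by exact: expR_ge0.
have hle := EE_pair_invariant haarP uV uVN bw (bPsi X) w_ge0 pw.
rewrite -(@pmulr_rge0 _ (2 * s ^+ 2 * th)) ?mulr_gt0 ?exprn_gt0 //.
move: hle; set v := EE P w; set y := EE P _ => hle.
rewrite (_ : 2 * s ^+ 2 * th * (_ + _) = 2 * s ^+ 2 * th * y + s ^+ 3 * c * v) //.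
by field; exact: lt0r_neq0.
Qed.

(** Only the normalised [x] satisfies the cubic relation; [Psi] is homogeneous of degree 2 in the
    generator, so the sign carries over to [c *: eta x]. *)
Lemma stationarity p : 0 <= EE P (fun U => w U * Psi (eta (ugen R p)) U).
Proof.
have [c c0 [x /= eX X3]] := etaugen_cube R p.
have XT : (eta x)^T = - eta x.
  have := etaugen_tr R p; rewrite /= eX linearZ /= -scalerN.
  by move/(congr1 (fun A => c^-1 *: A)); rewrite !scalerA mulVf ?scale1r ?gt_eqF.
have h := stationarity_rot XT X3.
have d1 U : dev1 k z U (c *: eta x) = c *: dev1 k z U (eta x).
  by rewrite /dev1 -scalemxAl -scalemxAr -scalerBr -scalemxAr -scalemxAl.
have d2 U : dev2 k z U (c *: eta x) = c ^+ 2 *: dev2 k z U (eta x).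
  rewrite /dev2 [(c *: eta x)^T]linearZ /= scalemxAl scalemxAr; congr (_ *m _ *m _).
  rewrite -!(scalemxAl, scalemxAr) !scalerA -expr2.
  move: (_ *m _ *m Mn z U) (Mn z U *m _) (_ *m Mn z U *m _) => A B C.
  by apply/matrixP => i j; rewrite !mxE; ring.
have PsiZ U : Psi (c *: eta x) U = c ^+ 2 * Psi (eta x) U.
  by rewrite /Psi /der1 /der2 d1 d2 !fdotZr fsqZ; ring.
rewrite eX (_ : EE P _ = c ^+ 2 * EE P (fun U => w U * Psi (eta x) U)).
  by rewrite mulr_ge0 ?sqr_ge0.
rewrite -EEZ; last exact: bddmeasM.
by apply: eq_Rintegral => U _; rewrite PsiZ mulrCA.
Qed.

Variable zm : R.
Hypothesis n_gt0 : (0 < n)%N.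
Hypothesis z_ge1 : forall j, 1 <= z j.
Hypothesis z_le : forall j, z j <= zm.
Hypothesis th_le : 2 * th <= n%:R / (64 * zm ^+ 2).

Lemma EE_exp_dev_le (b : R) :
  32 * k%:R ^+ 2 * avg_energy z * zm + 32 * k%:R ^+ 3 * zm ^+ 2 / n%:R <= b ->
  0 <= EE P (fun U => w U * (b - 2 * n%:R * f U)).
Proof.
move=> hb.
apply: (@le_trans _ _ (EE P (fun U => \sum_p w U * Psi (eta (ugen R p)) U))).
  rewrite EE_sum; last by move=> p; exact: bddmeasM.
  by apply: sumr_ge0 => p _; exact: stationarity.
apply: EE_le.
- by apply: bddmeas_sum => p; exact: bddmeasM.
- apply: bddmeasM => //; apply: bddmeasD; first exact: bddmeas_cst.
  by apply: bddmeasN; apply: bddmeasM => //; exact: bddmeas_cst.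
- move=> U uU; rewrite -mulr_sumr ler_wpM2l ?expR_ge0 //.
  have th0 : 0 <= 2 * th by rewrite mulr_ge0 // ltW.
  apply: le_trans (sum_derivatives_le kn n_gt0 z_ge1 z_le uU th0 th_le) _.
  by rewrite lerD2r.
Qed.

Lemma dev_tail (a tau : R) : 0 < a -> 2 * a <= tau ->
  32 * k%:R ^+ 2 * avg_energy z * zm + 32 * k%:R ^+ 3 * zm ^+ 2 / n%:R
    <= 2 * n%:R * a ->
  fine (P [set U : cmx_meas R n | tau <= f U]) <= expR (- (th * tau / 2)).
Proof.
move=> a0 atau hb; set A := [set U | _].
have mA : measurable A.
  rewrite /A (_ : [set U | _] = f @^-1` `[tau, +oo[%classic); last first.
    by apply/seteqP; split => U /=; rewrite in_itv /= andbT.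
  rewrite -[X in measurable X]setTI; have [mf _] := bf; exact: mf.
have bA : bddmeas (\1_A : cmx_meas R n -> R).
  split; first exact: measurable_indic.
  by exists 1 => U _; rewrite indicE; case: (_ \in _); rewrite ?normr1 ?normr0.
have n0 : 0 < n%:R :> R by rewrite ltr0n.
have h0 := EE_exp_dev_le hb.
have b1 := @bddmeas_cst R n (2 * n%:R * (a * expR (th * a))).
have b2 : bddmeas (fun U => - (2 * n%:R * (expR (th * tau) * (tau - a))) * \1_A U).
  by apply: bddmeasM => //; exact: bddmeas_cst.
have h1 : 0 <= EE P (fun U => 2 * n%:R * (a * expR (th * a)) +
    - (2 * n%:R * (expR (th * tau) * (tau - a))) * \1_A U).
  apply: le_trans h0 _; apply: EE_le.
  - apply: bddmeasM => //; apply: bddmeasD; first exact: bddmeas_cst.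
    by apply: bddmeasN; apply: bddmeasM => //; exact: bddmeas_cst.
  - exact: bddmeasD.
  move=> U uU; rewrite indicE.
  rewrite (_ : w U * _ = 2 * n%:R * (expR (th * f U) * (a - f U))); last by rewrite /w; ring.
  rewrite (_ : _ + _ = 2 * n%:R * (a * expR (th * a) -
      expR (th * tau) * (tau - a) * (U \in A)%:R)); last by ring.
  rewrite ler_wpM2l ?mulr_ge0 //.
  have f0 : 0 <= f U by exact: fsq_ge0.
  have e0 := expR_gt0 (th * a).
  (* On [A] the factor [a - f U] is at most [a - tau < 0] and the weight at least [expR (th * tau)].
     Off [A], either [f U <= a] bounds the weight or the left side is negative. *)
  have [UA|UA] := boolP (U \in A).
    have tf : tau <= f U by move: UA; rewrite inE.
    have : expR (th * tau) <= expR (th * f U) by rewrite ler_expR ler_wpM2l // ltW.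
    have := expR_gt0 (th * tau); rewrite mulr1; nra.
  rewrite mulr0 subr0; have [fa|fa] := leP (f U) a.
    have : expR (th * f U) <= expR (th * a) by rewrite ler_expR ler_wpM2l // ltW.
    have := expR_gt0 (th * f U); nra.
  have := expR_gt0 (th * f U); nra.
rewrite (EED P b1 b2) (EEZ P _ bA) (EE_indic haarP mA) in h1.
rewrite (_ : EE P _ = 2 * n%:R * (a * expR (th * a))) in h1; last first.
  rewrite -[RHS]mulr1 -(EE1 haarP) -EEZ; last exact: bddmeas_cst.
  by apply: eq_Rintegral => U _; rewrite mulr1.
have pA0 : 0 <= fine (P A) by rewrite fine_ge0.
move: h1 pA0; move: (fine (P A)) => pA h1 pA0.
have h2 : expR (th * tau) * (tau - a) * pA <= a * expR (th * a).
  by rewrite -(@ler_pM2l _ (2 * n%:R)) ?mulr_gt0 //; lra.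
(* Here [tau - a >= a] is used; below, [a <= tau / 2] gives the final exponent. *)
have h3 : expR (th * tau) * pA <= expR (th * a).
  have et := expR_gt0 (th * tau).
  rewrite -(@ler_pM2l _ a) //; apply: le_trans h2.
  rewrite mulrAC [leRHS]mulrC ler_wpM2r ?mulr_ge0 ?expR_ge0 //; lra.
have h4 : pA <= expR (th * a - th * tau).
  by rewrite expRD expRN ler_pdivlMr ?expR_gt0 // mulrC.
apply: le_trans h4 _; rewrite ler_expR.
have := ler_wpM2l (ltW th_gt0) atau; lra.
Qed.

End Concentration.

(** * Measurability of the deviation event *)

Import numFieldNormedType.Exports.

Lemma continuous_bigop_seq (R : realType) (T : topologicalType) (op : R -> R -> R) idx
    (I : Type) (s : seq I) (F : I -> T -> R) :
  (forall g h : T -> R, continuous g -> continuous h -> continuous (fun x => op (g x) (h x))) ->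
  (forall i, continuous (F i)) -> continuous (fun x => \big[op/idx]_(i <- s) F i x).
Proof.
move=> hop hF; elim: s => [|i s IH].
  by under eq_fun do rewrite big_nil; move=> x; exact: cvg_cst.
by under eq_fun do rewrite big_cons; exact: hop.
Qed.

(** A countable dense set in the region where all coordinates are at least 1; the successor keeps
    the denominator positive. *)
Definition gridpt (R : realType) k (p : nat * {ffun 'I_k -> nat}) : 'rV[R]_k :=
  \row_j (1 + (p.2 j)%:R / p.1.+1%:R).

(** Replaces an uncountable existential by countable operations. A zero is approached by grid points
    through continuity; conversely 0 is adherent to the image of a compact box, which is closed. *)
Lemma exists_zero_grid (R : realType) k (B : R) (H : 'rV[R]_k -> R) :
  continuous H -> (forall v, 0 <= H v) ->
  (exists2 v : 'rV[R]_k, (forall j, 1 <= v 0 j <= B) & H v = 0) <->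
  (forall m : nat, exists2 p : nat * {ffun 'I_k -> nat},
     (forall j, gridpt R p 0 j <= B) & H (gridpt R p) < m.+1%:R^-1).
Proof.
move=> cH H0; split=> [[v vB Hv] m|h].
  have : nbhs v (H @^-1` ball (H v) m.+1%:R^-1).
    by apply: cH; apply: nbhsx_ballx; rewrite invr_gt0.
  move=> /nbhs_ballP[d /= d0 hd].
  pose N := Num.truncn d^-1.
  have Nd : N.+1%:R^-1 < d.
    by rewrite invf_plt ?posrE // truncnS_gt.
  (* Rounding down keeps the grid point below the bound [B]. *)
  pose q := [ffun j => Num.truncn ((v 0 j - 1) * N.+1%:R)].
  have qv j : gridpt R (N, q) 0 j <= v 0 j < gridpt R (N, q) 0 j + N.+1%:R^-1.
    have v1 : 0 <= (v 0 j - 1) * N.+1%:R.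
      by rewrite mulr_ge0 // subr_ge0; have /andP[] := vB j.
    rewrite mxE /= ffunE; set t := Num.truncn _.
    have /andP[t1 t2] := truncn_itv v1.
    have N0 : 0 < N.+1%:R :> R by [].
    have t1' : t%:R / N.+1%:R <= v 0 j - 1 by rewrite ler_pdivrMr.
    have t2' : v 0 j - 1 < t.+1%:R / N.+1%:R by rewrite ltr_pdivlMr.
    rewrite -[t.+1%:R]natr1 mulrDl mul1r in t2'.
    by apply/andP; split; [rewrite -lerBrDl|rewrite -addrA -ltrBlDl].
  exists (N, q) => [j|].
    have /andP[h1 _] := qv j; have /andP[_] := vB j; exact: le_trans.
  have : ball (H v) m.+1%:R^-1 (H (gridpt R (N, q))).
    apply: hd; split => // i j /=; rewrite ord1.
    have /andP[h1 h2] := qv j; rewrite /ball /= ger0_norm ?subr_ge0 //.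
    by rewrite ltrBlDl (lt_trans h2) // ltrD2l.
  by rewrite /ball /= Hv sub0r normrN ger0_norm.
pose A : set 'rV[R]_k := [set v | forall j, `[1, B]%classic (v ord0 j)].
have cA : compact A.
  apply: (@rV_compact _ _ (fun=> `[1, B]%classic)) => _; exact: segment_compact.
have cHA : compact (H @` A).
  by apply: continuous_compact => //; exact: continuous_subspaceT.
have clA : closed (H @` A) by apply: compact_closed => //; exact: norm_hausdorff.
have : closure (H @` A) 0.
  move=> W /nbhs_ballP[e /= e0 he].
  pose m := Num.truncn e^-1.
  have me : m.+1%:R^-1 < e by rewrite invf_plt ?posrE // truncnS_gt.
  have [p pB pm] := h m; exists (H (gridpt R p)); split.
    exists (gridpt R p) => // j; rewrite /= in_itv /= pB andbT mxE lerDl.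
    by rewrite divr_ge0.
  apply: he; rewrite /ball /= sub0r normrN ger0_norm //.
  exact: lt_trans pm me.
rewrite -(closure_id _).1 // => -[v vA Hv]; by exists v.
Qed.

Section MeasurableEvent.
Variables (R : realType) (n k : nat) (z : 'I_n -> R).
Hypothesis kn : (k <= n)%N.

Let N (U : cmx_meas R n) : 'M[R]_(k + k) := Jk R k *m Mnk k z U.

Lemma bddmeas_JMnk : bddmeas_mx N.
Proof.
apply: bddmeas_mxM; first exact: bddmeas_mx_cst.
have h := bddmeas_mxD (bddmeas_dev z kn) (bddmeas_mx_cst n (avg_energy z)%:M).
by move=> i j; have := h i j; under eq_fun do rewrite subrK.
Qed.

Lemma bddmeas_det p (F : cmx_meas R n -> 'M[R]_p) :
  bddmeas_mx F -> bddmeas (fun U => \det (F U)).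
Proof.
move=> hF; apply: bddmeas_sum => s; apply: bddmeasZ.
elim: (index_enum _) => [|i r IH].
  by under eq_fun do rewrite big_nil; exact: bddmeas_cst.
by under eq_fun do rewrite big_cons; exact: bddmeasM.
Qed.

Let g (i : nat) (U : cmx_meas R n) : R := \det (i%:R%:M - N U).

Let bg i : bddmeas (g i).
Proof.
apply: bddmeas_det; apply: bddmeas_mxD; first exact: bddmeas_mx_cst.
exact/bddmeas_mxN/bddmeas_JMnk.
Qed.

(** Encodes equality of two polynomials of degree [2 k] by their values at the [2 k + 1] points 0,
    ..., [2 k]; [(X - i v)(X + i v)] takes the value [i^2 + v^2] at the integer point [i]. *)
Let H (U : cmx_meas R n) (v : 'rV[R]_k) : R :=
  \sum_(i < (k + k).+1) (g i U - \prod_(j < k) (i%:R ^+ 2 + v 0 j ^+ 2)) ^+ 2.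

Lemma symplectic_eigenvaluesP (U : cmx_meas R n) (la : 'I_k -> R) :
  symplectic_eigenvalues (Mnk k z U) la <->
  (forall j, 1 <= la j) /\ H U (\row_j la j) = 0.
Proof.
set p := char_poly (map_mx (real_complex R) (N U)).
set q := \prod_(j < k) (('X - ((0 : R) +i* la j)%C%:P) * ('X - ((0 : R) -i* la j)%C%:P)).
have pE i : p.[i%:R] = ((g i U)%:C)%C.
  rewrite /p horner_char_poly_det /g -det_map_mx; congr (\det _).
  by apply/matrixP => a b; rewrite !mxE rmorphB rmorphMn rmorph_nat.
have qE i : q.[i%:R] = ((\prod_(j < k) (i%:R ^+ 2 + (\row_j la j) 0 j ^+ 2))%:C)%C.
  rewrite horner_prod rmorph_prod /=; apply: eq_bigr => j _.
  rewrite hornerM !hornerXsubC mxE.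
  apply/eqP; rewrite eq_complex -[i%:R in X in X && _](rmorph_nat (real_complex R)).
  rewrite -[i%:R in X in _ && X](rmorph_nat (real_complex R)) /=.
  by apply/andP; split; apply/eqP; ring.
have pq : p = q <-> H U (\row_j la j) = 0.
  split=> [epq|H0].
    rewrite /H big1 // => i _; apply/eqP; rewrite sqrf_eq0 subr_eq0; apply/eqP.
    by apply: (@complexI R); rewrite -pE -qE epq.
  apply/eqP; rewrite -subr_eq0; apply/eqP.
  apply: (@roots_geq_poly_eq0 _ _ [seq i%:R | i <- iota 0 (k + k).+1]).
  - rewrite all_map; apply/allP => i; rewrite mem_iota add0n => /andP[_ ik] /=.
    rewrite rootE hornerD hornerN pE qE subr_eq0; apply/eqP; congr (_%:C)%C.
    move/eqP: H0; rewrite psumr_eq0; last by move=> *; exact: sqr_ge0.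
    move/allP => /(_ (Ordinal ik) (mem_index_enum _)) /=.
    by rewrite sqrf_eq0 subr_eq0 => /eqP.
  - by rewrite map_inj_uniq ?iota_uniq // => i j /eqP; rewrite eqr_nat => /eqP.
  - rewrite size_map size_iota (leq_trans (size_polyD _ _)) // size_polyN geq_max.
    rewrite size_char_poly leqnn /=.
    have -> : q = \prod_(a <- [seq ((0 : R) +i* la j)%C | j <- index_enum 'I_k] ++
          [seq ((0 : R) -i* la j)%C | j <- index_enum 'I_k]) ('X - a%:P).
      by rewrite /q big_split /= big_cat !big_map.
    rewrite size_prod_XsubC size_cat !size_map.
    by rewrite -!sum1_size !big_const_ord !iter_addn_0 mul1n.
by split => -[h1 h2]; split => //; apply/pq.
Qed.

(** The union over the integer [B] confines the eigenvalues to a box, where [exists_zero_grid]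
    applies. *)
Lemma measurable_symplectic :
  measurable [set U : cmx_meas R n | exists la : 'I_k -> R,
    symplectic_eigenvalues (Mnk k z U) la].
Proof.
have cH U : continuous (H U).
  apply: continuous_bigop_seq => [g1 g2 c1 c2 x|i].
    exact: (cvgD (c1 x) (c2 x)).
  have cst (c : R) : continuous (fun _ : 'rV[R]_k => c) by exact: cst_continuous.
  have cprod : continuous (fun v : 'rV[R]_k => \prod_(j < k) (i%:R ^+ 2 + v 0 j ^+ 2)).
    apply: continuous_bigop_seq => [g1 g2 c1 c2 x|j v].
      exact: (cvgM (c1 x) (c2 x)).
    have cv := @coord_continuous R 1 k 0 j v.
    exact: (cvgD (cst (i%:R ^+ 2) v) (cvgM cv cv)).
  move=> v; exact: (cvgM (cvgB (cst (g i U) v) (cprod v)) (cvgB (cst (g i U) v) (cprod v))).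
have H0 U v : 0 <= H U v by apply: sumr_ge0 => i _; exact: sqr_ge0.
have mH v m : measurable [set U | H U v < m.+1%:R^-1].
  have bH : bddmeas (fun U => H U v).
    apply: bddmeas_sum => i; under eq_fun do rewrite expr2.
    by apply: bddmeasM; apply: bddmeasD => //; exact: bddmeas_cst.
  rewrite (_ : [set U | _] = (fun U => H U v) @^-1` `]-oo, m.+1%:R^-1[%classic); last first.
    by apply/seteqP; split => U /=; rewrite in_itv.
  by rewrite -[X in measurable X]setTI; have [mh _] := bH; exact: mh.
rewrite (_ : [set U | _] = \bigcup_(B : nat) \bigcap_(m : nat)
    \bigcup_(p : nat * {ffun 'I_k -> nat})
      [set U : cmx_meas R n | (forall j, gridpt R p 0 j <= B%:R) /\ H U (gridpt R p) < m.+1%:R^-1]).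
  apply: bigcupT_measurable => B; apply: bigcapT_measurable => m.
  apply: countable_bigcupT_measurable => [|p]; first exact: countableP.
  have [pB|pB] := pselect (forall j, gridpt R p 0 j <= B%:R).
    rewrite (_ : [set U | _] = [set U | H U (gridpt R p) < m.+1%:R^-1]) //.
    by apply/seteqP; split => U //= -[].
  rewrite (_ : [set U | _] = set0) //.
  by apply/seteqP; split => U //= -[].
apply/seteqP; split => U /=.
  move=> [la /symplectic_eigenvaluesP[la1 Hla]].
  pose B := (\sum_j (Num.truncn (la j)).+1)%N; exists B => // m _.
  have : exists2 v : 'rV[R]_k, (forall j, 1 <= v 0 j <= B%:R) & H U v = 0.
    exists (\row_j la j) => // j; rewrite mxE la1 /=.
    rewrite (le_trans (ltW (truncnS_gt _))) // ler_nat /B (bigD1 j) //=.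
    exact: leq_addr.
  move=> /(exists_zero_grid _ (cH U) (H0 U)) /(_ m) [p pB pm].
  by exists p.
move=> [B _ hB].
have [v vB Hv] : exists2 v : 'rV[R]_k, (forall j, 1 <= v 0 j <= B%:R) & H U v = 0.
  apply/(exists_zero_grid _ (cH U) (H0 U)) => m.
  by have [p _ [pB pm]] := hB m I; exists p.
exists (fun j => v 0 j); apply/symplectic_eigenvaluesP; split.
  by move=> j; have /andP[] := vB j.
rewrite -Hv; congr H; apply/matrixP => i j; by rewrite !mxE ord1.
Qed.

(** Whenever symplectic eigenvalues exist, the sum equals half a trace depending on [U] alone, so
    the existential decouples from the inequality. *)
Lemma measurable_deviation_event eps : measurable (deviation_event k z eps).
Proof.
pose Y (U : cmx_meas R n) := sympl_sqr_dev k z U.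
have bY : bddmeas_mx Y.
  apply: bddmeas_mxD; last exact: bddmeas_mx_cst.
  by apply: bddmeas_mxM; exact: bddmeas_JMnk.
have btr : bddmeas (fun U => \tr (Y U *m Y U)).
  by apply: bddmeas_sum => i; exact: bddmeas_mxM.
rewrite (_ : deviation_event k z eps =
    [set U : cmx_meas R n | exists la : 'I_k -> R, symplectic_eigenvalues (Mnk k z U) la] `&`
    (fun U => \tr (Y U *m Y U)) @^-1` `]2 * eps, +oo[%classic).
  apply: measurableI; first exact: measurable_symplectic.
  by rewrite -[X in measurable X]setTI; have [mh _] := btr; exact: mh.
apply/seteqP; split => U /=; rewrite in_itv /= andbT.
  move=> [la [hla he]]; split; first by exists la.
  by rewrite /Y -(symplectic_sum_trace (avg_energy z) hla) ltr_pM2l.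
move=> [[la hla] he]; exists la; split => //.
by move: he; rewrite /Y -(symplectic_sum_trace (avg_energy z) hla) ltr_pM2l.
Qed.

End MeasurableEvent.

(** * The tail bound at fixed n *)

Section FixedSize.
Variables (R : realType) (n k : nat) (z : 'I_n -> R) (zm : R).
Variable P : probability (cmx_meas R n) R.
Hypothesis haarP : is_Haar P.
Hypothesis k_gt0 : (0 < k)%N.
Hypothesis kn : (k <= n)%N.
Hypothesis z_ge1 : forall j, 1 <= z j.
Hypothesis z_le : forall j, z j <= zm.

Let n_gt0 : (0 < n)%N. Proof. exact: leq_trans kn. Qed.
Let zm1 : 1 <= zm := zm_ge1 n_gt0 z_ge1 z_le.

Lemma deviation_tail (a eps : R) : 0 < a ->
  32 * k%:R ^+ 2 * avg_energy z * zm + 32 * k%:R ^+ 3 * zm ^+ 2 / n%:R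
    <= 2 * n%:R * a ->
  (4 * avg_energy z ^+ 2 + 2 * a) * (2 * a) <= eps ->
  (P (deviation_event k z eps) <=
   (expR (- (n%:R / (128 * zm ^+ 2) * (eps ^+ 2 / (512 * k%:R * zm ^+ 6)) / 2)))%:E)%E.
Proof.
move=> a0 ha heps.
set th := n%:R / (128 * zm ^+ 2); set q := eps ^+ 2 / _.
have zm0 : 0 < zm by apply: lt_le_trans zm1.
have n0 : 0 < n%:R :> R by rewrite ltr0n.
have k0 : 0 < k%:R :> R by rewrite ltr0n.
have th0 : 0 < th by rewrite divr_gt0 // mulr_gt0 // exprn_gt0.
have thle : 2 * th <= n%:R / (64 * zm ^+ 2).
  rewrite le_eqVlt; apply/orP; left; apply/eqP; rewrite /th.
  by field; rewrite lt0r_neq0.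
pose tau := Num.max (2 * a) q.
have at2 : 2 * a <= tau by rewrite le_max lexx.
have qt : q <= tau by rewrite le_max lexx orbT.
have tail := dev_tail kn haarP th0 n_gt0 z_ge1 z_le thle a0 at2 ha.
have mE := measurable_deviation_event z kn eps.
have mD := @measurable_unitary_group R n.
have bf := bddmeas_fsq (bddmeas_dev z kn).
set A := [set U : cmx_meas R n | _] in tail.
have mA : measurable A.
  rewrite /A (_ : [set U | _] =
      (fun U : cmx_meas R n => fsq (dev k z U)) @^-1` `[tau, +oo[%classic); last first.
    by apply/seteqP; split => U /=; rewrite in_itv /= andbT.
  by rewrite -[X in measurable X]setTI; have [mf _] := bf; exact: mf.
(* The bounds linear in [f] are available on U(n) only; its complement is a null set. *)
have sub : deviation_event k z eps `<=` A `|` ~` @unitary_group R n.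
  move=> U [la [hla he]]; have [uU|nuU] := pselect (unitary (U : 'M[R[i]]_n)); last by right.
  left; rewrite /A /=.
  have F2 := symplectic_sum_trace (avg_energy z) hla.
  have q1 := tr_sympl_sqr_dev_quad k z U.
  have q2 := tr_sympl_sqr_dev_lin kn n_gt0 z_ge1 z_le uU.
  have q3 := fsq_dev_le kn n_gt0 z_ge1 z_le uU.
  rewrite /= -/(sympl_sqr_dev k z U) in F2.
  move: F2 q1 q2 q3 he; set F := \sum_(j < k) _; set f := fsq _.
  have f0 : 0 <= f by exact: fsq_ge0.
  move: (\tr _) => T F2; rewrite -F2 => q1 q2 q3 he.
  have l2 : 0 <= avg_energy z ^+ 2 by exact: sqr_ge0.
  (* [f >= 2 a] follows from the quadratic bound and the lower bound on [eps]; [f >= q] from the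
     linear bound and [f <= 8 k zm^2], with [512 = 64 * 8]. *)
  rewrite ge_max; apply/andP; split.
    rewrite leNgt; apply/negP => fa.
    suff : F <= (4 * avg_energy z ^+ 2 + 2 * a) * (2 * a).
      by move=> /le_trans /(_ heps); rewrite leNgt he.
    apply: (@le_trans _ _ ((4 * avg_energy z ^+ 2 + f) * f)); first by lra.
    by apply: ler_pM => //; [lra|lra|exact: ltW].
  have eps0 : 0 <= eps by apply: le_trans heps; rewrite mulr_ge0 //; lra.
  have kz : 0 < 512 * k%:R * zm ^+ 6.
    by have := mulr_gt0 k0 (exprn_gt0 6 zm0); lra.
  rewrite /q ler_pdivrMr //.
  have F0 : 0 <= F by apply: le_trans eps0 (ltW he).
  have eF : eps ^+ 2 <= F ^+ 2 by rewrite lerXn2r // ltW.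
  have Fl : F <= 8 * zm ^+ 2 * f by lra.
  have FF : F ^+ 2 <= (8 * zm ^+ 2 * f) ^+ 2 by rewrite lerXn2r // nnegrE mulr_ge0 // mulr_ge0 ?sqr_ge0.
  apply: le_trans eF (le_trans FF _).
  rewrite (_ : (8 * zm ^+ 2 * f) ^+ 2 = f * (64 * zm ^+ 4) * f); last by ring.
  rewrite (_ : f * (512 * _ * _) = f * (64 * zm ^+ 4) * (8 * k%:R * zm ^+ 2)); last by ring.
  rewrite ler_wpM2l // mulr_ge0 //; have := exprn_ge0 4 (ltW zm0); lra.
have PD0 : P (~` @unitary_group R n) = 0%E.
  by have [P1 _] := haarP; rewrite probability_setC // P1 subee.
apply: (@le_trans _ _ (P (A `|` ~` @unitary_group R n))).
  apply: le_measure => //; rewrite inE //.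
  by apply: measurableU => //; exact: measurableC.
apply: le_trans (measureU2 _ _ _) _ => //; first exact: measurableC.
rewrite [X in (_ + X)%E](_ : _ = 0%E) ?adde0; last exact: PD0.
apply: (@le_trans _ _ (fine (P A))%:E); first by rewrite fineK // fin_num_measure.
rewrite lee_fin (le_trans tail) // ler_expR lerN2.
by rewrite ler_wpM2r // ler_wpM2l // ltW.
Qed.

End FixedSize.

(** * From fixed size to powers of [n] *)

Lemma powR_natr_ge1 (R : realType) (n : nat) (r : R) :
  (1 <= n)%N -> 0 <= r -> 1 <= n%:R `^ r.
Proof.
move=> n1 r0; rewrite /powR gt_eqF ?ltr0n // -[leLHS]expR0 ler_expR mulr_ge0 //.
by rewrite ln_ge0 // ler1n.
Qed.

(** The finitely many sizes below [N] are covered by adding the sum of all their entries to the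
    constant, since [n^zeta >= 1]. *)
Lemma bound_for_all_sizes (R : realType) (zeta : R) (z : forall n : nat, 'I_n -> R) :
  0 <= zeta -> (forall n (j : 'I_n), 1 <= z n j) ->
  (exists C : R, 0 < C /\ exists N : nat, forall n : nat, (N <= n)%N ->
     forall j : 'I_n, z n j <= C * (n%:R `^ zeta)) ->
  exists2 C : R, 0 < C & forall n : nat, (1 <= n)%N ->
     forall j : 'I_n, z n j <= C * (n%:R `^ zeta).
Proof.
move=> zeta0 z1 [C [C0 [N hN]]].
have z0 n j : 0 <= z n j by apply: le_trans (z1 n j).
pose T := \sum_(m < N) \sum_(j < m) z m j.
have T0 : 0 <= T by apply: sumr_ge0 => m _; exact: sumr_ge0.
exists (C + T); first by rewrite ltr_wpDr.
move=> n n1 j.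
have p1 : 1 <= n%:R `^ zeta :> R.
  exact: powR_natr_ge1.
have [Nn|nN] := leqP N n.
  by apply: le_trans (hN n Nn j) _; rewrite ler_wpM2r ?lerDl // (le_trans ler01).
have zT : z n j <= T.
  rewrite /T (bigD1 (Ordinal nN)) //= (bigD1 j) //= -addrA lerDl addr_ge0 //.
    exact: sumr_ge0.
  by apply: sumr_ge0 => m _; exact: sumr_ge0.
apply: (le_trans zT); rewrite -[leLHS]mulr1; apply: ler_pM => //.
by rewrite lerDr ltW.
Qed.

Unset Implicit Arguments.

Theorem theorem2 (R : realType) (zeta kappa : R)
  (z : forall n : nat, 'I_n -> R) (ks : nat -> nat) :
  0 <= zeta -> 0 <= kappa ->
  8 * zeta + kappa < 1 -> zeta + 2 * kappa < 1 ->
  (* entries of Z_n are >= 1 *)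
  (forall n (j : 'I_n), 1 <= z n j) ->
  (* bounded squeezing of degree zeta: ||Z_n||_oo = max_j z_j^(n) <= C n^zeta *)
  (exists C : R, 0 < C /\ exists N : nat, forall n : nat, (N <= n)%N ->
     forall j : 'I_n, z n j <= C * (n%:R `^ zeta)) ->
  (* uniformly bounded average energy *)
  (exists L : R, forall n : nat, avg_energy (z n) <= L) ->
  (* subsystem sizes k_n in {1, ..., n} *)
  (forall n : nat, (1 <= n)%N -> (1 <= ks n <= n)%N) ->
  (* bounded of degree kappa *)
  (exists K : R, 0 < K /\ exists N : nat, forall n : nat, (N <= n)%N ->
     (ks n)%:R <= K * (n%:R `^ kappa)) ->
  exists C c : R, 0 < C /\ 0 < c /\
    forall n : nat, (1 <= n)%N ->
    forall P : probability (cmx_meas R n) R, is_Haar P ->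
    forall eps : R, C * (n%:R `^ (zeta + 2 * kappa - 1)) < eps ->
      (P (deviation_event (ks n) (z n) eps) <=
         (expR (- c * eps ^+ 2 * (n%:R `^ (1 - 8 * zeta - kappa))))%:E)%E.
Proof.
move=> zeta0 kappa0 _ hzk z1 hz [L hL] hks hk.
have [C C0 hC] := bound_for_all_sizes zeta0 z1 hz.
have [K K0 hK] : exists2 K : R, 0 < K &
    forall n : nat, (1 <= n)%N -> (ks n)%:R <= K * (n%:R `^ kappa).
  move: hk => [K [K0 [N hN]]]; exists (K + N%:R); first by rewrite ltr_wpDr.
  move=> n n1.
  have q1 : 1 <= n%:R `^ kappa :> R.
    exact: powR_natr_ge1.
  have [Nn|nN] := leqP N n.
    by apply: le_trans (hN n Nn) _; rewrite ler_wpM2r ?lerDl // (le_trans ler01).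
  apply: (@le_trans _ _ (N%:R * 1)).
    rewrite mulr1 ler_nat; have /andP[_ kn] := hks n n1.
    exact: leq_trans kn (ltnW nN).
  by apply: ler_pM => //; rewrite lerDr ltW.
pose L1 := Num.max L 1.
have L10 : 0 < L1 by rewrite lt_max ltr01 orbT.
(* Bounds [b / (2 n)] by [A * x], where [x = n^(zeta + 2 kappa - 1)]: insert [k <= K n^kappa] and
   [zm = C n^zeta]; 16 is 32 / 2. *)
pose A := 16 * (K ^+ 2 * L1 * C + K ^+ 3 * C ^+ 2).
have A0 : 0 < A by rewrite mulr_gt0 // addr_gt0 // !mulr_gt0 // exprn_gt0.
(* The threshold of [deviation_tail] at [a = A * x]; since [x <= 1], one factor [A * x] is replaced
   by [A], which leaves it linear in [x]. *)
pose C' := (4 * L1 ^+ 2 + 2 * A) * (2 * A).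
pose c := (128 * C ^+ 2)^-1 * (512 * K * C ^+ 6)^-1 / 2.
exists C', c; split; first by rewrite mulr_gt0 // ?addr_gt0 // mulr_gt0 // exprn_gt0.
have c0 : 0 < c.
  have d1 : 0 < 128 * C ^+ 2 by have := exprn_gt0 2 C0; lra.
  have d2 : 0 < 512 * K * C ^+ 6 by have := mulr_gt0 K0 (exprn_gt0 6 C0); lra.
  rewrite /c; apply: divr_gt0; last exact: ltr0n.
  by apply: mulr_gt0; rewrite invr_gt0.
split=> // n n1 P haarP eps heps.
have /andP[k1 kn] := hks n n1.
have n0 : 0 < n%:R :> R by rewrite ltr0n.
have nE := lnK n0.
set l := ln n%:R in nE.
have l0 : 0 <= l by rewrite ln_ge0 // ler1n.
have pw (r : R) : n%:R `^ r = expR (r * l) by rewrite /powR gt_eqF.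
set p : R := n%:R `^ zeta; set q : R := n%:R `^ kappa.
have p0 : 0 < p by rewrite /p pw expR_gt0.
have q0 : 0 < q by rewrite /q pw expR_gt0.
have q1 : 1 <= q by rewrite /q pw -[leLHS]expR0 ler_expR mulr_ge0.
set x := n%:R `^ (zeta + 2 * kappa - 1) in heps.
have xE : x = p * q ^+ 2 / n%:R.
  rewrite /x /p /q !pw -[in RHS]nE -expRM_natl -expRD -expRN -expRD; congr expR; ring.
have yE : n%:R `^ (1 - 8 * zeta - kappa) = n%:R / (p ^+ 8 * q).
  rewrite /p /q !pw -[in RHS]nE -expRM_natl -expRD -expRN -expRD; congr expR; ring.
have x0 : 0 < x by rewrite xE divr_gt0 // mulr_gt0 // exprn_gt0.
have x1 : x <= 1 by rewrite /x pw -[leRHS]expR0 ler_expR; nra.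
have pqn : p * q ^+ 2 = x * n%:R by rewrite xE divfK // gt_eqF.
have z_le j : z n j <= C * p by exact: hC.
set k : R := (ks n)%:R.
have k0 : 0 < k by rewrite ltr0n.
have kK : k <= K * q by exact: hK.
have /andP[lam1 _] := avg_energy_bounds n1 (z1 n) z_le.
have lamL : avg_energy (z n) <= L1 by rewrite le_max hL.
have lam0 : 0 <= avg_energy (z n) by apply: le_trans lam1.
have a0 : 0 < A * x by rewrite mulr_gt0.
have Cp0 : 0 < C * p by rewrite mulr_gt0.
have ha : 32 * k ^+ 2 * avg_energy (z n) * (C * p) + 32 * k ^+ 3 * (C * p) ^+ 2 / n%:R
    <= 2 * n%:R * (A * x).
  have k2 : k ^+ 2 <= (K * q) ^+ 2 by rewrite lerXn2r // nnegrE ltW // mulr_gt0.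
  have k3 : k ^+ 3 <= (K * q) ^+ 3 by rewrite lerXn2r // nnegrE ltW // mulr_gt0.
  have t1 : k ^+ 2 * avg_energy (z n) * (C * p) <= (K * q) ^+ 2 * L1 * (C * p).
    by rewrite ler_pM2r // ler_pM // sqr_ge0.
  have t2 : k ^+ 3 * (C * p) ^+ 2 / n%:R <= (K * q) ^+ 3 * (C * p) ^+ 2 / n%:R.
    by rewrite ler_pM2r ?invr_gt0 // ler_pM2r // exprn_gt0.
  (* One factor [p q^2] equals [x n], and the remaining [p q] is at most [p q^2 <= n], since
     [q >= 1] and [x <= 1]. *)
  have t3 : (K * q) ^+ 3 * (C * p) ^+ 2 / n%:R <= K ^+ 3 * C ^+ 2 * (x * n%:R).
    rewrite ler_pdivrMr //.
    rewrite (_ : (K * q) ^+ 3 * (C * p) ^+ 2 = K ^+ 3 * C ^+ 2 * (p * q ^+ 2) * (p * q)); last by ring.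
    rewrite pqn ler_pM2l ?mulr_gt0 ?exprn_gt0 //.
    apply: (@le_trans _ _ (p * q ^+ 2)).
      by rewrite ler_pM2l // expr2 -[leLHS]mulr1 ler_pM2l.
    by rewrite pqn -[leRHS]mul1r ler_pM2r.
  have t4 : (K * q) ^+ 2 * L1 * (C * p) = K ^+ 2 * L1 * C * (x * n%:R).
    by rewrite -pqn; ring.
  rewrite /A; lra.
have heps' : (4 * avg_energy (z n) ^+ 2 + 2 * (A * x)) * (2 * (A * x)) <= eps.
  apply: le_trans (ltW heps).
  have -> : C' * x = (4 * L1 ^+ 2 + 2 * A) * (2 * (A * x)) by rewrite /C'; ring.
  have l2 : avg_energy (z n) ^+ 2 <= L1 ^+ 2 by rewrite lerXn2r // nnegrE // ltW.
  have ax : A * x <= A by rewrite -[leRHS]mulr1 ler_pM2l.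
  by apply: ler_wpM2r; lra.
have := deviation_tail haarP k1 kn (z1 n) z_le a0 ha heps'.
move=> /le_trans; apply; rewrite lee_fin ler_expR -/k yE mulNr mulNr lerN2.
(* The bound at fixed size has [1 / k] in the exponent; this ratio replaces it by
   [1 / (K n^kappa)]. *)
have kqK : K * q / k >= 1 by rewrite ler_pdivlMr // mul1r.
have e2 : 0 <= eps ^+ 2 := sqr_ge0 eps.
set v := leRHS.
have -> : v = c * eps ^+ 2 * (n%:R / (p ^+ 8 * q)) * (K * q / k).
  by rewrite /v /c; field; rewrite ?lt0r_neq0.
rewrite -[leLHS]mulr1 ler_wpM2l // mulr_ge0 //; last first.
  by rewrite divr_ge0 // ?mulr_ge0 ?exprn_ge0 // ltW.
by rewrite mulr_ge0 // ltW.
Qed.
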